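(* Let $\varepsilon\in(0,1)$, let $k\ge0$, and let $\mathcal{G}^{(k)}$ be a memory-$k$ stochastic temporal graph on an underlying graph $G=(V,E)$ with $n$ vertices and $m$ edges, with two designated vertices $s,y$, such that every edge appearance probability (for every edge and every history) is at least $\frac{1}{n^c}$ for some $c\geq 1$. Then Minimum Arrival admits a fully polynomial randomized approximation scheme which runs in time $O\left(m\frac{n^{5c+8}}{\varepsilon^4}\log\frac{n}{\varepsilon}\right)$ and outputs a value $\widetilde{X}$ with $(1-\varepsilon)\mathbb{E}[X(s,y)]\leq\widetilde{X}\leq(1+\varepsilon)\mathbb{E}[X(s,y)]$ with probability at least $1-\frac{2}{n}$.
   Context: For $k\geq 1$, a memory-$k$ stochastic temporal graph on $G=(V,E)$ is specified by initial snapshots $G_{-k+1},\ldots,G_0\subseteq G$ and, for every edge $e\in E$ and every $h\in\{0,1\}^k$, a probability $p_e(h)$. For each time $t\geq1$, letting $H_e^{(k)}\in\{0,1\}^k$ record the presence ($1$) or absence ($0$) of $e$ in the snapshots $G_{t-k},\ldots,G_{t-1}$, edge $e$ belongs to the snapshot $G_t=(V,E_t)$ with probability $p_e(H_e^{(k)})$, independently of all other edges. The memory-$0$ (memoryless) model: each edge $e$ appears at each time $t\ge1$ independently with fixed probability $p_e$. An $s$-$y$ journey is a sequence $((e_1,t_1),\ldots,(e_x,t_x))$ with $e_i\in E_{t_i}$, $(e_1,\ldots,e_x)$ a path from $s$ to $y$ in $G$, and $1\le t_1<\cdots<t_x$; its arrival time is $t_x$. $X(s,y)$ is the minimum arrival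 time of an $s$-$y$ journey. Minimum Arrival asks for $\mathbb{E}[X(s,y)]$. *)

(* Defs.v *)
(* MathComp / MathComp-Analysis development. *)
From HB Require Import structures.
From mathcomp Require Export all_boot all_order all_algebra.
From mathcomp Require Export all_classical all_reals all_analysis.

Set Implicit Arguments.
Unset Strict Implicit.
Unset Printing Implicit Defensive.

Import Order.TTheory GRing.Theory Num.Theory.
Import numFieldNormedType.Exports.

Local Open Scope classical_set_scope.
Local Open Scope ring_scope.

(** * Stochastic temporal graphs *)

(* A finite simple undirected graph with vertex set 'I_n and m edges.  The
   edges are listed in some order, each with its endpoints in some order; both
   orders are arbitrary and are the ones an algorithm sees in its input. *)
Record sgraph (n m : nat) := SGraph {
  ends : 'I_m -> 'I_n * 'I_n;
  ends_neq : forall e, (ends e).1 != (ends e).2;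
  ends_inj : injective (fun e => [set (ends e).1; (ends e).2]%SET)
}.

Definition edge n m (G : sgraph n m) (e : 'I_m) : {set 'I_n} :=
  [set (ends G e).1; (ends G e).2]%SET.

(* A snapshot is given by its set of edges.  [init] lists G_{-k+1}, ..., G_0,
   in this order, and a history lists the presence bits oldest first. *)
Record memory_model (R : realType) (m k : nat) := MemoryModel {
  init : k.-tuple {set 'I_m};
  pr : 'I_m -> k.-tuple bool -> R;
  pr_prob : forall e h, 0 <= pr e h <= 1
}.

(* [past] is G_1, ..., G_{t-1}.  In init ++ past the snapshot G_i has index
   i + k - 1, so the snapshots G_{t-k}, ..., G_{t-1} are those of index
   t - 1 + j = size past + j, for j < k. *)
Definition history (R : realType) m k (M : memory_model R m k)
    (past : seq {set 'I_m}) (e : 'I_m) : k.-tuple bool :=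
  [tuple e \in nth finset.set0 (init M ++ past) (size past + j) | j < k].

Section process.
Variables (R : realType) (m k : nat) (d : measure_display).
Variables (T : measurableType d) (P : probability T R).

(* G_1(w), ..., G_t(w); the value of the process at time 0 is never used *)
Definition snapshots (Gs : nat -> T -> {set 'I_m}) (t : nat) (w : T) :
  seq {set 'I_m} := [seq Gs i w | i <- iota 1 t].

(* Gs is a sequence of random snapshots on (T, P) governed by the model M:
   conditionally on G_1, ..., G_{t-1}, the edges are present in G_t
   independently of one another, e with probability p_e(H_e).  The
   conditional probability is multiplied out by that of the past, which may
   vanish.  The snapshots G_{-k+1}, ..., G_0 are deterministic. *)
Definition governed_by (M : memory_model R m k) (Gs : nat -> T -> {set 'I_m}) :=
  (forall t S, (0 < t)%N -> measurable [set w | Gs t w = S]) /\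
  (forall (past : seq {set 'I_m}) (S : {set 'I_m}),
     P [set w | snapshots Gs (size past).+1 w = rcons past S] =
     (P [set w | snapshots Gs (size past) w = past] *
      (\prod_(e < m) (if e \in S then pr M e (history M past e)
                      else 1 - pr M e (history M past e)))%:E)%E).

End process.

(** * Journeys and arrival times *)

(* the edges es lead from x through the successive vertices vs *)
Fixpoint walk n m (G : sgraph n m) (x : 'I_n) (es : seq 'I_m)
    (vs : seq 'I_n) : bool :=
  match es, vs with
  | [::], [::] => true
  | e :: es', v :: vs' => (edge G e == [set x; v]%SET) && walk G v es' vs'
  | _, _ => false
  end.

Definition gpath n m (G : sgraph n m) (x y : 'I_n) (es : seq 'I_m) : Prop :=
  exists vs, [/\ walk G x es vs, uniq (x :: vs) & last x vs = y].

Definition journey n m (G : sgraph n m) (E : nat -> {set 'I_m}) (x y : 'I_n)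
    (j : seq ('I_m * nat)) : Prop :=
  [/\ all (fun et => et.1 \in E et.2) j,
      gpath G x y (unzip1 j)
    & path ltn 0%N (unzip2 j)].

Definition arrival m (j : seq ('I_m * nat)) : nat := last 0%N (unzip2 j).

(* X(x, y), for x != y; it is +oo when there is no journey *)
Definition min_arrival (R : realType) n m (G : sgraph n m)
    (E : nat -> {set 'I_m}) (x y : 'I_n) : \bar R :=
  ereal_inf [set ((arrival j)%:R)%:E | j in journey G E x y].

(* The library's 'E_P[_] only covers real-valued variables, hence the
   integral. *)
Definition expected_arrival (R : realType) n m (G : sgraph n m)
    (d : measure_display) (T : measurableType d) (P : probability T R)
    (Gs : nat -> T -> {set 'I_m}) (x y : 'I_n) : \bar R :=
  (\int[P]_w min_arrival R G (Gs ^~ w) x y)%E.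

(** * Randomized algorithms *)

(* Unit-cost random access machine, with structured control flow.  Memory
   consists of arrays of natural numbers and arrays of reals (a scalar variable
   is cell 0 of an array).  On natural numbers only addition, truncated
   subtraction and comparison are available, so that a computation cannot build
   superpolynomially large integers in polynomial time; on reals the field
   operations and comparisons.  The only constants are natural numbers. *)
Inductive nexp : Type :=
  | NConst of nat
  | NGet of nat & nexp                      (* array, index *)
  | NAdd of nexp & nexp
  | NSub of nexp & nexp.

Inductive rexp : Type :=
  | RNat of nexp
  | RGet of nat & nexp
  | RAdd of rexp & rexp
  | RSub of rexp & rexp
  | RMul of rexp & rexp
  | RDiv of rexp & rexp.

Inductive bexp : Type :=
  | NLt of nexp & nexp
  | RLt of rexp & rexp
  | RLe of rexp & rexp.

Inductive cmd : Type :=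
  | Skip
  | NSet of nat & nexp & nexp               (* array, index, value *)
  | RSet of nat & nexp & rexp
  | Flip of nat & nexp & rexp               (* array, index, bias *)
  | Seq of cmd & cmd
  | If of bexp & cmd & cmd
  | While of bexp & cmd.

Record state (R : realType) := State {
  narr : nat -> nat -> nat;
  rarr : nat -> nat -> R
}.

Definition upd (V : Type) (f : nat -> nat -> V) (a i : nat) (v : V) :
    nat -> nat -> V :=
  fun b j => if (b == a) && (j == i) then v else f b j.

Definition nset (R : realType) (st : state R) (a i v : nat) : state R :=
  State (upd (narr st) a i v) (rarr st).

Definition rset (R : realType) (st : state R) (a i : nat) (v : R) : state R :=
  State (narr st) (upd (rarr st) a i v).

Fixpoint neval (R : realType) (st : state R) (x : nexp) : nat :=
  match x with
  | NConst c => c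
  | NGet a i => narr st a (neval st i)
  | NAdd x1 x2 => neval st x1 + neval st x2
  | NSub x1 x2 => neval st x1 - neval st x2
  end%N.

Fixpoint reval (R : realType) (st : state R) (x : rexp) : R :=
  match x with
  | RNat x1 => (neval st x1)%:R
  | RGet a i => rarr st a (neval st i)
  | RAdd x1 x2 => reval st x1 + reval st x2
  | RSub x1 x2 => reval st x1 - reval st x2
  | RMul x1 x2 => reval st x1 * reval st x2
  | RDiv x1 x2 => reval st x1 / reval st x2
  end.

Definition beval (R : realType) (st : state R) (b : bexp) : bool :=
  match b with
  | NLt x1 x2 => (neval st x1 < neval st x2)%N
  | RLt x1 x2 => reval st x1 < reval st x2
  | RLe x1 x2 => reval st x1 <= reval st x2
  end.

(* Probability that the execution of the commands K, one after the other, from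
   the state st halts within N steps in a state satisfying Q.  Every command
   and every test is one step; expressions are part of the program text, so
   charging for the operators they contain would only change running times by
   a constant factor.  [Flip a i p] stores in cell i of array a a fresh bit
   which is 1 with probability p (truncated to [0, 1]). *)
Fixpoint prob (R : realType) (N : nat) (K : seq cmd) (st : state R)
    (Q : pred (state R)) : R :=
  match K with
  | [::] => (Q st)%:R
  | c :: K' =>
    match N with
    | 0%N => 0
    | N'.+1 =>
      match c with
      | Skip => prob N' K' st Q
      | NSet a i v => prob N' K' (nset st a (neval st i) (neval st v)) Q
      | RSet a i v => prob N' K' (rset st a (neval st i) (reval st v)) Q
      | Flip a i p =>
          let q := Num.max 0 (Num.min 1 (reval st p)) in
          q * prob N' K' (nset st a (neval st i) 1) Q
          + (1 - q) * prob N' K' (nset st a (neval st i) 0) Q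
      | Seq c1 c2 => prob N' [:: c1, c2 & K'] st Q
      | If b c1 c2 => prob N' ((if beval st b then c1 else c2) :: K') st Q
      | While b c1 =>
          prob N' (if beval st b then [:: c1, While b c1 & K'] else K') st Q
      end
    end
  end.

(** * Input and output of an algorithm for Minimum Arrival *)

(* a bit string, most significant bit first, as a number below 2 ^ size h *)
Definition code (h : seq bool) : nat :=
  foldl (fun a (b : bool) => (a.*2 + b)%N) 0%N h.

(* Input layout (all other cells are 0):
   - natural array 0: n, m, source, target, number 2 ^ k of histories;
   - natural arrays 1 and 2: the endpoints of each edge;
   - natural array 3: the code of the history at time 1 of each edge, that is,
     its presence in G_{-k+1}, ..., G_0;
   - real array 0: the accuracy eps and the exponent c;
   - real array 1: p_e(h), at index e * 2 ^ k + code h (no two pairs (e, h)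
     share an index). *)
Definition input (R : realType) n m k (G : sgraph n m)
    (M : memory_model R m k) (x y : 'I_n) (eps c : R) : state R :=
  State
    (fun a i =>
       match a with
       | 0 => nth 0 [:: n; m; val x; val y; 2 ^ k] i
       | 1 => if insub i is Some e then val (ends G e).1 else 0
       | 2 => if insub i is Some e then val (ends G e).2 else 0
       | 3 => if insub i is Some e then code (history M [::] e) else 0
       | _ => 0
       end)%N
    (fun a i =>
       match a with
       | 0%N => nth 0 [:: eps; c] i
       | 1%N => if [pick eh : 'I_m * k.-tuple bool
                    | i == (eh.1 * 2 ^ k + code eh.2)%N] is Some eh
                then pr M eh.1 eh.2 else 0
       | _ => 0
       end).

(* The output is the first cell of real array 2, or +oo if the first cell of
   natural array 4 is nonzero: the expected arrival time is infinite when the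
   target cannot be reached in the underlying graph. *)
Definition output (R : realType) (st : state R) : \bar R :=
  if narr st 4 0 == 0%N then (rarr st 2 0)%:E else +oo%E.

Definition accurate (R : realType) (eps : R) (E : \bar R) : pred (state R) :=
  fun st => (((1 - eps)%:E * E <= output st) &&
             (output st <= (1 + eps)%:E * E))%E.

(* Main.v *)
Require Import Defs.
From mathcomp Require Import all_boot all_order all_algebra.
From mathcomp Require Import all_classical all_reals all_analysis.
From mathcomp Require Import measurable_realfun ring lra zify.
Import Order.TTheory GRing.Theory Num.Theory.
Import numFieldNormedType.Exports.
Local Open Scope ring_scope.

Set Implicit Arguments.
Unset Strict Implicit.
Unset Printing Implicit Defensive.

(* The algorithm computes N = ceil (4 n^2 Q / eps^2) with Q = n^(ceil c),
   simulates N steps of the process N times, and outputs the average of the N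
   values of min (X, N), or +oo if this average is at least N; no separate
   test of connectivity is needed.

   As long as y is not reached, some edge leaves the set of reached vertices,
   and it appears with probability at least 1/Q; so the number of unreached
   vertices, times Q, bounds the expected remaining time, and hence
   E [X] <= n Q from every past.  Conditioning on the first step gives
   E [min (X, N)^2] <= 2 n Q E [min (X, N)], so that by Chebyshev's inequality
   the average is within eps/2 of E [min (X, N)], relatively, with probability
   at least 1 - 2/n.  The bias is E [X] - E [min (X, N)] <= n Q P (X > N)
   <= (n Q / N) E [min (X, N)], again by restarting at time N and by Markov's
   inequality.  If y is unreachable, every sample equals N. *)

(** * The process as a finite recursion *)

Section RandomSubset.
Variables (R : realType) (m : nat).
Implicit Types (p : 'I_m -> R) (H : {set 'I_m} -> R).

Definition subset_expect p H : R :=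
  \sum_(S : {set 'I_m}) (\prod_(e < m) (if e \in S then p e else 1 - p e)) * H
    S.

Lemma eq_subset_expect p q H H' : p =1 q -> H =1 H' ->
  subset_expect p H = subset_expect q H'.
Proof.
move=> pq HH; apply: eq_bigr => S _; rewrite HH; congr (_ * _).
by apply: eq_bigr => e _; rewrite pq.
Qed.

(** The weights are the terms in the expansion of the product of the factors p e + (1 - p e) = 1. *)
Lemma subset_expect_cst p a : subset_expect p (fun=> a) = a.
Proof.
rewrite /subset_expect -mulr_suml -bigA_distr big1 ?mul1r// => e _.
by rewrite /= addrC subrK.
Qed.

Lemma subset_expectD p H H' :
  subset_expect p (fun S => H S + H' S) = subset_expect p H + subset_expect p
    H'.
Proof. by rewrite -big_split; apply: eq_bigr => S _; rewrite mulrDr. Qed.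

Lemma subset_expectZ p a H :
  subset_expect p (fun S => a * H S) = a * subset_expect p H.
Proof. by rewrite mulr_sumr; apply: eq_bigr => S _; rewrite mulrCA. Qed.

Lemma subset_expect_le p H H' : (forall e, 0 <= p e <= 1) ->
  (forall S, H S <= H' S) -> subset_expect p H <= subset_expect p H'.
Proof.
move=> p01 HH; apply: ler_sum => S _; apply: ler_wpM2l => //.
by apply: prodr_ge0 => e _; have /andP[? ?] := p01 e; case: ifP => // _; lra.
Qed.

Definition set_prob p (e : 'I_m) x := fun e' : 'I_m => if e' == e then x else p
  e'.

(** Conditioning on the presence of [e]. The program draws edges one by one, and this identity
    matches one [Flip] with the law of a whole snapshot. *)
Lemma subset_expect_split p (e : 'I_m) H :
  subset_expect p H = p e * subset_expect (set_prob p e 1) H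
                      + (1 - p e) * subset_expect (set_prob p e 0) H.
Proof.
rewrite /subset_expect 2!mulr_sumr -big_split; apply: eq_bigr => S _ /=.
have E (q : 'I_m -> R) : \prod_(i < m) (if i \in S then q i else 1 - q i) =
    (if e \in S then q e else 1 - q e) *
    \prod_(i < m | i != e) (if i \in S then q i else 1 - q i).
  by rewrite (bigD1 e).
have Ex x : \prod_(i < m | i != e)
    (if i \in S then set_prob p e x i else 1 - set_prob p e x i) =
    \prod_(i < m | i != e) (if i \in S then p i else 1 - p i).
  by apply: eq_bigr => i; rewrite /set_prob => /negPf ->.
by rewrite !E !Ex /set_prob eqxx; case: ifP => _; ring.
Qed.

Lemma subset_expect_det (S : {set 'I_m}) H :
  subset_expect (fun e => (e \in S)%:R) H = H S.
Proof.
rewrite /subset_expect (bigD1 S)//= [X in X * _]big1 ?mul1r; last first.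
  by move=> e _; case: (e \in S); rewrite ?subr0.
rewrite big1 ?addr0// => S' neS.
have [e eS] : exists e, (e \in S') != (e \in S).
  apply/existsP; rewrite -negb_forall; apply: contra neS => /forallP eS.
  by apply/eqP/setP => e; apply/eqP.
rewrite (bigD1 e)//= [X in X * _ * _](_ : _ = 0) ?mul0r//.
by case: (e \in S') (e \in S) eS => [] [] // _; rewrite subrr.
Qed.

Lemma subset_expect_mem p (e : 'I_m) : subset_expect p (fun S => (e \in S)%:R)
  = p e.
Proof.
rewrite (subset_expect_split _ e).
have mem x : x = 0 \/ x = 1 ->
    subset_expect (set_prob p e x) (fun S => (e \in S)%:R) = x.
  move=> x01; rewrite -[RHS](subset_expect_cst (set_prob p e x)).
  apply: eq_bigr => S _; rewrite (bigD1 e)//= /set_prob eqxx.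
  by case: x01 => ->; case: (e \in S); rewrite ?subrr ?mul0r.
by rewrite mem ?mem; [ring | left | right].
Qed.

End RandomSubset.

(** * Moments and tails of the truncated arrival time *)

Section Process.
Variables (R : realType) (n m k : nat) (G : sgraph n m).
Variables (M : memory_model R m k) (s y : 'I_n).
Implicit Types (past : seq {set 'I_m}) (H : nat -> R) (A : {set 'I_n}).

(** [u] ranges over the old set [A]: times strictly increase along a journey, so one snapshot
    prolongs it by at most one edge. *)
Definition spread A (S : {set 'I_m}) : {set 'I_n} :=
  (A :|: [set v | [exists e in S, exists u in A, edge G e == [set u; v]]])%SET.

Definition reached past : {set 'I_n} := foldl spread [set s]%SET past.

Definition missed past : bool := y \notin reached past.

Definition next_prob past e : R := pr M e (history M past e).

Definition next_expect past (H : seq {set 'I_m} -> R) : R :=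
  subset_expect (next_prob past) (fun S => H (rcons past S)).

Lemma next_prob01 past e : 0 <= next_prob past e <= 1.
Proof. exact: pr_prob. Qed.

Lemma reached_rcons past S : reached (rcons past S) = spread (reached past) S.
Proof. by rewrite /reached foldl_rcons. Qed.

Lemma sub_spread A S : A \subset spread A S.
Proof. exact: finset.subsetUl. Qed.

Lemma missed_rcons past S : missed (rcons past S) -> missed past.
Proof.
rewrite /missed reached_rcons; apply: contra => h.
exact: (fintype.subsetP (sub_spread _ _)) h.
Qed.

(* the law of [acc + min (X, N)], X being the time remaining after [past] *)
Fixpoint run_expect N past (acc : nat) H : R :=
  match N with
  | 0%N => H acc
  | N'.+1 => next_expect past
               (fun past' => run_expect N' past' (acc + missed past)%N H)
  end.

(** Every run restarts from the empty past, which makes the samples independent; [acc] carries their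
    sum. *)
Fixpoint samples_expect N r (acc : nat) H : R :=
  match r with
  | 0%N => H acc
  | r'.+1 => run_expect N [::] acc (fun a => samples_expect N r' a H)
  end.

(** With X the time remaining after [past], this is P (X > t); [mean] and [moment2] are the first
    two moments of min (X, N), by conditioning on the first step. *)
Fixpoint tail t past : R :=
  match t with
  | 0%N => (missed past)%:R
  | t'.+1 => next_expect past (tail t')
  end.

Fixpoint mean N past : R :=
  match N with
  | 0%N => 0
  | N'.+1 => (missed past)%:R + next_expect past (mean N')
  end.

(** If the target is missed, min (X, N) is 1 + Y, with Y the truncated time left after one step; its
    square is 1 + 2 Y + Y^2. *)
Fixpoint moment2 N past : R :=
  match N with
  | 0%N => 0
  | N'.+1 => (missed past)%:R * (1 + 2 * next_expect past (mean N'))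
             + next_expect past (moment2 N')
  end.

Lemma next_expect_le past (H H' : seq {set 'I_m} -> R) :
  (forall S, H (rcons past S) <= H' (rcons past S)) ->
  next_expect past H <= next_expect past H'.
Proof. by move=> HH; apply: subset_expect_le => //; apply: next_prob01. Qed.

Lemma eq_next_expect past (H H' : seq {set 'I_m} -> R) :
  H =1 H' -> next_expect past H = next_expect past H'.
Proof. by move=> HH; apply: eq_subset_expect => // S; rewrite HH. Qed.

Lemma eq_run_expect N past acc H H' : H =1 H' ->
  run_expect N past acc H = run_expect N past acc H'.
Proof.
move=> HH; elim: N past acc => [|N IH] past acc /=; first exact: HH.
by apply: eq_next_expect => past'; apply: IH.
Qed.

(** Functions of this quadratic shape are stable under a run, so that Chebyshev's test function can
    be integrated exactly over all samples. *)
Lemma run_expect_quadratic N past acc (a b c : R) :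
  run_expect N past acc (fun x => a * (x%:R + b) ^+ 2 + c) =
  a * ((acc%:R + b) ^+ 2 + 2 * (acc%:R + b) * mean N past + moment2 N past) + c.
Proof.
elim: N past acc => [|N IH] past acc /=; first by rewrite mulr0 !addr0.
under eq_next_expect => past' do rewrite IH.
have Ep (H1 H2 : seq {set 'I_m} -> R) (a0 a1 a2 : R) :
    next_expect past (fun p => a0 + a1 * H1 p + a2 * H2 p) =
    a0 + a1 * next_expect past H1 + a2 * next_expect past H2.
  by rewrite /next_expect !subset_expectD subset_expect_cst !subset_expectZ.
set d := (acc + missed past)%:R.
transitivity (next_expect past (fun p => (a * (d + b) ^+ 2 + c)
   + (a * (2 * (d + b))) * mean N p + a * moment2 N p)).
  by apply: eq_next_expect => p; ring.
(* The case analysis is needed because the indicator equals its own square. *)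
rewrite Ep /d natrD; case: (missed past) => /=; ring.
Qed.

Lemma run_expect_cst N past acc (c : R) : run_expect N past acc (fun=> c) = c.
Proof.
elim: N past acc => [//|N IH] past acc /=.
by under eq_next_expect do rewrite IH; rewrite /next_expect subset_expect_cst.
Qed.

Lemma run_expect_le N past acc H H' : (forall a, H a <= H' a) ->
  run_expect N past acc H <= run_expect N past acc H'.
Proof.
move=> HH; elim: N past acc => [|N IH] past acc //=.
by apply: next_expect_le.
Qed.

Lemma samples_expect_cst N r acc (c : R) : samples_expect N r acc (fun=> c) = c.
Proof.
elim: r acc => [//|r IH] acc /=.
by rewrite (eq_run_expect _ _ _ IH) run_expect_cst.
Qed.

Lemma samples_expect_le N r acc H H' : (forall a, H a <= H' a) ->
  samples_expect N r acc H <= samples_expect N r acc H'.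
Proof.
by move=> HH; elim: r acc => [|r IH] acc //=; apply: run_expect_le => a.
Qed.

Let mu N := mean N [::].
Let var N := moment2 N [::] - mu N ^+ 2.

Lemma samples_expect_square N r acc (a b c : R) :
  samples_expect N r acc (fun x => a * (x%:R + b) ^+ 2 + c) =
  a * ((acc%:R + r%:R * mu N + b) ^+ 2 + r%:R * var N) + c.
Proof.
elim: r acc => [|r IH] acc /=; first by rewrite !mul0r !addr0.
(* The mean of the later samples shifts [b], and their variance goes into the constant. *)
transitivity (run_expect N [::] acc (fun x =>
    a * (x%:R + (r%:R * mu N + b)) ^+ 2 + (a * (r%:R * var N) + c))).
  by apply: eq_run_expect => x; rewrite IH addrA; ring.
by rewrite run_expect_quadratic -/(mu N) /var -natr1; ring.
Qed.

(* Chebyshev's inequality *)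
Lemma samples_expect_close N r (eta : R) (H : nat -> R) : 0 < eta ->
  (forall a, 0 <= H a) ->
  (forall a : nat, `|a%:R - r%:R * mu N| <= eta -> 1 <= H a) ->
  1 - r%:R * var N / eta ^+ 2 <= samples_expect N r 0 H.
Proof.
move=> eta0 H0 H1.
(* The test function 1 - (x - r mu)^2 / eta^2 is at most 1, and negative at distance more than eta
   from r mu, so it lies below [H]. *)
have := samples_expect_square N r 0 (- (eta ^- 2)) (- (r%:R * mu N)) 1.
rewrite add0r subrr expr0n add0r mulNr [_^-1 * _]mulrC addrC => <-.
apply: samples_expect_le => a.
have e2 : 0 < eta ^+ 2 by rewrite exprn_gt0.
have [le|gt] := leP `|a%:R - r%:R * mu N| eta.
  apply: le_trans (H1 _ le); rewrite mulNr gerDr oppr_le0.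
  by rewrite mulr_ge0 ?invr_ge0 ?sqr_ge0 ?ltW.
apply: le_trans (H0 a); rewrite mulNr addrC subr_le0 mulrC ler_pdivlMr// mul1r.
by rewrite -[leRHS]real_normK ?num_real// lerXn2r ?nnegrE// ltW.
Qed.

Lemma tail_ge0 t past : 0 <= tail t past.
Proof.
elim: t past => [|t IH] past /=; first by rewrite ler0n.
rewrite -[leLHS](subset_expect_cst (next_prob past)).
by apply: subset_expect_le => //; apply: next_prob01.
Qed.

(** min (X, N) counts the times t < N with X > t. *)
Lemma mean_tail N past : mean N past = \sum_(t < N) tail t past.
Proof.
elim: N past => [|N IH] past /=; first by rewrite big_ord0.
rewrite big_ord_recl /=; congr (_ + _).
under eq_next_expect do rewrite IH.
elim: N {IH} => [|N IH]; first by under eq_next_expect do rewrite big_ord0;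
  rewrite big_ord0 /next_expect subset_expect_cst.
rewrite big_ord_recr /= -IH -subset_expectD.
by apply: eq_subset_expect => // S; rewrite big_ord_recr.
Qed.

Lemma tail_decr t past : tail t.+1 past <= tail t past.
Proof.
elim: t past => [|t IH] past /=.
  rewrite -[leRHS](subset_expect_cst (next_prob past)).
  apply: subset_expect_le => [|S]; first exact: next_prob01. rewrite ler_nat.
  by case: missed (@missed_rcons past S) => // ->.
by apply: next_expect_le => S; apply: IH.
Qed.

Lemma tail_le t t' past : (t <= t')%N -> tail t' past <= tail t past.
Proof.
by move=> /subnK <-; elim: (t' - t)%N => [//|i]; apply/le_trans/tail_decr.
Qed.

(** Markov's inequality: the tails decrease, so each of the first t of them is at least the one at
    t. *)
Lemma tail_mean t past : t%:R * tail t past <= mean t past.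
Proof.
rewrite mean_tail mulr_natl -[X in _ *+ X]card_ord -sumr_const.
by apply: ler_sum => i _; apply/tail_le/ltnW.
Qed.

Lemma mean_missed N past : ~~ missed past -> mean N past = 0.
Proof.
elim: N past => [//|N IH] past h /=; rewrite (negPf h) add0r.
rewrite -[RHS](subset_expect_cst (next_prob past)); apply: eq_subset_expect =>
  // S.
by apply: IH; apply: contra h; apply: missed_rcons.
Qed.

(** * Moment bounds when every cut between the two vertices is crossed by an edge *)

Section Reachable.
Variable Q : R.
Hypothesis Q1 : 1 <= Q.
Hypothesis prQ : forall e h, Q^-1 <= pr M e h.
Hypothesis crossing : forall A, s \in A -> y \notin A ->
  exists e u v, [/\ u \in A, v \notin A & edge G e = [set u; v]%SET].

Let s_reached past : s \in reached past.
Proof.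
elim/last_ind: past => [|past S IH]; first by rewrite /reached /= inE.
by rewrite reached_rcons (fintype.subsetP (sub_spread _ _)).
Qed.

(* The number of vertices not yet reached drops by at least one with
   probability at least 1/Q at each step. *)
Lemma mean_potential N past :
  mean N past <= #|(~: reached past)%SET|%:R * Q * (missed past)%:R.
Proof.
have Q0 : 0 < Q by apply: lt_le_trans Q1.
elim: N past => [|N IH] past; first by rewrite !mulr_ge0// ltW.
case ms: (missed past); last first.
  by rewrite mean_missed ?ms// mulr0.
rewrite /= ms /= mulr1.
have [e [u [v [uA vA euv]]]] := crossing (s_reached past) ms.
set A := reached past in uA vA *.
(* Only the crossing edge [e] is credited: its presence lowers the potential by at least Q. *)
have step S : mean N (rcons past S) <=
    #|(~: A)%SET|%:R * Q + (- Q) * (e \in S)%:R.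
  apply: le_trans (IH _) _.
  apply: (@le_trans _ _ (#|(~: reached (rcons past S))%SET|%:R * Q)).
    by case: missed; rewrite ?mulr1// mulr0 mulr_ge0// ltW.
  rewrite [leRHS](_ : _ = (#|(~: A)%SET|%:R - (e \in S)%:R) * Q); last by ring.
  rewrite ler_wpM2r ?(ltW Q0)// reached_rcons -/A lerBrDr -natrD ler_nat.
  case eS: (e \in S); last first.
    by rewrite addn0 subset_leq_card// finset.setCS sub_spread.
  rewrite addn1; apply: proper_card; apply/properP; split.
    by rewrite finset.setCS sub_spread.
  exists v; rewrite !inE//= negbK; apply/orP; right.
  by apply/existsP; exists e; rewrite eS; apply/existsP; exists u; rewrite uA
    euv /=.
(* The bound depends on the new snapshot alone, which [last] reads off the extended past. *)
apply: (@le_trans _ _ (1 + next_expect past (fun past' =>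
    #|(~: A)%SET|%:R * Q + (- Q) * (e \in last finset.set0 past')%:R))).
  by rewrite lerD2l; apply: next_expect_le => S; rewrite last_rcons.
rewrite /next_expect subset_expectD subset_expect_cst subset_expectZ.
under eq_subset_expect => [i | S] do [over | rewrite last_rcons; over].
rewrite subset_expect_mem.
(* The expected drop of the potential pays for the step just spent. *)
suff : 1 <= Q * next_prob past e by lra.
rewrite -(mulfV (lt0r_neq0 Q0)) ler_pM2l//; exact: prQ.
Qed.

Lemma card_unreached past : (#|(~: reached past)%SET| < n)%N.
Proof.
rewrite -[X in (_ < X)%N](card_ord n) -(cardsC (reached past)).
by rewrite -[X in (X < _)%N]add0n ltn_add2r; apply/card_gt0P; exists s.
Qed.

Lemma mean_le N past : mean N past <= n%:R * Q * (missed past)%:R.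
Proof.
apply: le_trans (mean_potential N past) _.
rewrite ler_wpM2r// ler_wpM2r ?(le_trans ler01)// ler_nat.
exact/ltnW/card_unreached.
Qed.

(** Let U be the expected mean after one step. If the target is missed, 1 + U is the mean from
    [past], so 1 + 2 U <= 2 (1 + U) <= 2 n Q; induction bounds the remaining term by 2 n Q U. *)
Lemma moment2_le N past : moment2 N past <= 2 * n%:R * Q * mean N past.
Proof.
elim: N past => [|N IH] past /=; first by rewrite mulr0.
have hU : next_expect past (moment2 N) <=
    2 * n%:R * Q * next_expect past (mean N).
  rewrite -subset_expectZ; apply: subset_expect_le => [e|S]; last exact: IH.
  exact: next_prob01.
have := mean_le N.+1 past => /=; case: (missed past) => /=; last first.
  by rewrite mul0r !add0r => _.
by rewrite mulr1 => hV; nra.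
Qed.

(** Restart at time t: from any past the further expected time is at most n Q, and it is spent only
    if the target is still missed. *)
Lemma mean_add_le t N past :
  mean (t + N) past <= mean t past + n%:R * Q * tail t past.
Proof.
elim: t past => [|t IH] past /=; first by rewrite add0r; apply: mean_le.
rewrite -addrA lerD2l -subset_expectZ -subset_expectD.
by apply: subset_expect_le => [e|S]; [exact: next_prob01 | exact: IH].
Qed.

End Reachable.
End Process.

(** * Program logic *)

Section ProgramLogic.
Variable R : realType.
Implicit Types (f g h : state R -> R -> Prop) (Q : pred (state R)).

Lemma flip_bias01 (p : R) : 0 <= Num.max 0 (Num.min 1 p) <= 1.
Proof. by rewrite le_max lexx ge_max ler01 ge_min lexx. Qed.

Lemma prob_bounds N K (st : state R) Q : 0 <= prob N K st Q <= 1.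
Proof.
elim: N K st => [|N IH] [|[|a i v|a i v|a i p|c1 c2|b c1 c2|b c1] K] st //=;
  try by case: (Q st); rewrite ?lexx ?ler01.
have := flip_bias01 (reval st p); move: (Num.max _ _) => q /andP[q0 q1].
have /andP[a0 a1] := IH K (nset st a (neval st i) 1).
have /andP[b0 b1] := IH K (nset st a (neval st i) 0).
by apply/andP; split; nra.
Qed.

Lemma prob_leS N K (st : state R) Q : prob N K st Q <= prob N.+1 K st Q.
Proof.
elim: N K st => [|N IH] [|c K] st //; first by have /andP[] := prob_bounds 1 (c
  :: K) st Q.
case: c => [|a i v|a i v|a i p|c1 c2|b c1 c2|b c1] //; try exact: IH.
rewrite -[leLHS]/(_ * prob N K _ Q + _ * prob N K _ Q)
        -[leRHS]/(_ * prob N.+1 K _ Q + _ * prob N.+1 K _ Q).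
have /andP[q0 q1] := flip_bias01 (reval st p).
by rewrite lerD// ler_wpM2l ?subr_ge0.
Qed.

Lemma prob_le N N' K (st : state R) Q :
  (N <= N')%N -> prob N K st Q <= prob N' K st Q.
Proof.
by move=> /subnK <-; elim: (N' - N)%N => [//|i]; move/le_trans; apply; apply:
  prob_leS.
Qed.

(* An assertion [f st x] claims the lower bound [x] for the probability of
   success from [st]: if [g] bounds the rest of the execution from below
   after [c], then [f] does so before [c], at the price of [b] more steps. *)
Definition ensures (b : nat) (c : cmd) f g : Prop :=
  forall N K Q, (forall st x, g st x -> x <= prob N K st Q) ->
  forall st x, f st x -> x <= prob (b + N) (c :: K) st Q.

Lemma ensures_weaken b b' c f f' g g' :
  (b <= b')%N -> (forall st x, f' st x -> f st x) ->
  (forall st x, g st x -> g' st x) -> ensures b c f g -> ensures b' c f' g'.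
Proof.
move=> bb ff gg H N K Q HN st x fx.
apply: le_trans (H N K Q _ st x (ff _ _ fx)) _ => [st' x' /gg|]; first exact:
  HN.
by apply: prob_le; rewrite leq_add2r.
Qed.

Lemma ensures_seq b1 b2 c1 c2 f g h :
  ensures b1 c1 f h -> ensures b2 c2 h g ->
  ensures (b1 + b2).+1 (Seq c1 c2) f g.
Proof.
move=> H1 H2 N K Q HN st x fx; rewrite addSn -addnA /=.
by apply: H1 fx => st' x'; apply: H2.
Qed.

(** The number of iterations is fixed beforehand, whatever the coin flips, so termination comes with
    an exact step count; the last, failing test costs the extra step. *)
Lemma ensures_while J b t c (f : nat -> state R -> R -> Prop) :
  (forall j, (j < J)%N -> ensures b c (f j) (f j.+1)) ->
  (forall j st x, (j <= J)%N -> f j st x -> beval st t = (j < J)%N) ->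
  ensures (J * b.+1).+1 (While t c) (f 0%N) (f J).
Proof.
move=> Hc Ht.
suff H i : forall j, (j + i = J)%N -> ensures (i * b.+1).+1 (While t c) (f j)
  (f J).
  exact: H.
elim: i => [|i IH] j jJ N K Q HN st x fx.
  by move: fx; rewrite -[j]addn0 jJ => fx; rewrite /= (Ht J _ x)// ltnn; apply:
    HN.
have jlt : (j < J)%N by rewrite -jJ addnS ltnS leq_addr.
have -> : ((i.+1 * b.+1).+1 + N = (b + ((i * b.+1).+1 + N)).+1)%N.
  by rewrite mulSn; lia.
rewrite /= (Ht j _ x) ?(ltnW jlt)// jlt.
by apply: Hc fx => // st' x'; apply: IH; rewrite // addSnnS.
Qed.

Fixpoint cost (c : cmd) : nat :=
  match c with
  | Seq c1 c2 => (cost c1 + cost c2).+1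
  | If _ c1 c2 => (maxn (cost c1) (cost c2)).+1
  | _ => 1
  end.

(** For loop-free code only, hence [False] for [While]. At a [Flip] the claimed bound must be the
    average of the bounds for the two outcomes, with a bias that truncation leaves unchanged. *)
Fixpoint wp (c : cmd) (g : state R -> R -> Prop) (st : state R) (x : R) : Prop
  :=
  match c with
  | Skip => g st x
  | NSet a i v => g (nset st a (neval st i) (neval st v)) x
  | RSet a i v => g (rset st a (neval st i) (reval st v)) x
  | Flip a i p => 0 <= reval st p <= 1 /\
      exists x1 x0, [/\ x = reval st p * x1 + (1 - reval st p) * x0,
        g (nset st a (neval st i) 1) x1 & g (nset st a (neval st i) 0) x0]
  | Seq c1 c2 => wp c1 (wp c2 g) st x
  | If b c1 c2 => if beval st b then wp c1 g st x else wp c2 g st x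
  | While _ _ => False
  end.

Lemma ensures_wp c g : ensures (cost c) c (wp c g) g.
Proof.
elim: c g => [|a i v|a i v|a i p|c1 IH1 c2 IH2|b c1 IH1 c2 IH2|b c1 IH1] g //=;
  try by move=> N K Q HN st x; apply: HN.
- move=> N K Q HN st x [/andP[p0 p1] [x1 [x0 [-> g1 g0]]]] /=.
  rewrite (min_idPr p1) (max_idPr p0).
  by rewrite lerD// ler_wpM2l ?subr_ge0//; apply: HN.
- exact: ensures_seq (IH1 _) (IH2 _).
- move=> N K Q HN st x /=; case: ifP => _ fx.
    apply: le_trans (IH1 g N K Q HN _ _ fx) (prob_le _ _ _ _).
    by rewrite leq_add2r leq_maxl.
  apply: le_trans (IH2 g N K Q HN _ _ fx) (prob_le _ _ _ _).
  by rewrite leq_add2r leq_maxr.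
Qed.

Lemma ensures_straight b c f g : (cost c <= b)%N ->
  (forall st x, f st x -> wp c g st x) -> ensures b c f g.
Proof. by move=> cb H; apply: ensures_weaken (@ensures_wp c g).
Qed.

End ProgramLogic.

Definition var (i : nat) : nexp := NGet 7 (NConst i).
Definition set_var (i : nat) (x : nexp) : cmd := NSet 7 (NConst i) x.
Definition incr (i : nat) : cmd := set_var i (NAdd (var i) (NConst 1)).
Definition for_loop (i : nat) (bound : nexp) (c : cmd) : cmd :=
  Seq (set_var i (NConst 0)) (While (NLt (var i) bound) (Seq c (incr i))).

(** The assertion [f] ignores the counter, whose value is tracked beside it. Test, sequencing and
    increment add 3 steps to each iteration. *)
Lemma ensures_for (R : realType) J b i bound c (f : nat -> state R -> R ->
  Prop) :
  (forall j v st x, (j <= J)%N -> f j st x -> f j (nset st 7 i v) x) ->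
  (forall j st x, (j <= J)%N -> f j st x -> neval st bound = J) ->
  (forall j, (j < J)%N -> ensures b c (fun st x => narr st 7 i = j /\ f j st x)
                           (fun st x => narr st 7 i = j /\ f j.+1 st x)) ->
  ensures (J * b.+3).+3 (for_loop i bound c) (f 0%N) (f J).
Proof.
move=> f_var f_bound f_body.
pose g j (st : state R) x := narr st 7 i = j /\ f j st x.
have g_step j v st x : (j <= J)%N -> f j st x -> v = j -> g j (nset st 7 i v) x.
  by move=> jJ fx ->; split; [rewrite /= /upd !eqxx | apply: f_var].
apply: (@ensures_weaken _ (1 + (J * b.+3).+1).+1 _ _ (f 0%N) _ (g J)) => //.
- by move=> st x [].
- apply: (ensures_seq (h := g 0%N)).
    by apply: ensures_straight => // st x fx /=; apply: g_step.
  apply: ensures_while => [j jJ|j st x jJ [gj fx]]; last first.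
    by rewrite /= gj (f_bound _ _ _ jJ fx).
  apply: (@ensures_weaken _ (b + 1).+1 _ _ (g j) _ (g j.+1)) => //.
    by rewrite addn1.
  apply: ensures_seq (f_body _ jJ) _.
  apply: ensures_straight => // st x [gj fx] /=.
  by apply: g_step; rewrite // gj addn1.
Qed.

(** * Binary codes of histories *)

Section Code.

Lemma code_foldl a (h : seq bool) :
  foldl (fun a (b : bool) => (a.*2 + b)%N) a h = (a * 2 ^ size h + Defs.code
    h)%N.
Proof.
elim: h a => [|b h IH] a /=; first by rewrite expn0 muln1 addn0.
rewrite /Defs.code [in RHS]/= !IH expnS -muln2.
by case: b; rewrite /= ?mul0n ?mul1n; ring.
Qed.

Lemma code_cons (b : bool) h : Defs.code (b :: h) = (b * 2 ^ size h + Defs.code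
  h)%N.
Proof. by rewrite /Defs.code /= code_foldl. Qed.

Lemma code_rcons h (b : bool) : Defs.code (rcons h b) = (Defs.code h +
  Defs.code h + b)%N.
Proof. by rewrite /Defs.code foldl_rcons addnn. Qed.

Lemma code_lt h : (Defs.code h < 2 ^ size h)%N.
Proof.
elim: h => [//|b h IH]; rewrite code_cons /= expnS.
by case: b; rewrite ?mul1n ?mul0n; lia.
Qed.

Lemma code_inj h h' : size h = size h' -> Defs.code h = Defs.code h' -> h = h'.
Proof.
elim: h h' => [[]//|b h IH] [//|b' h'] [sz]; rewrite !code_cons sz => E.
have := code_lt h; have := code_lt h'; rewrite sz => l1 l2.
have [Eb Eh] : b = b' /\ Defs.code h = Defs.code h' by move: E; case: b; case:
  b'; lia.
by rewrite Eb (IH h').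
Qed.

(** Appending a bit doubles the code, and the bit that leaves the window is the most significant
    one, so one comparison and one subtraction remove it. *)
Lemma code_shift (h : seq bool) (b : bool) :
  let c := (Defs.code h + Defs.code h + b)%N in
  Defs.code (behead (rcons h b)) = if (c < 2 ^ size h)%N then c else (c - 2 ^
    size h)%N.
Proof.
rewrite /= -code_rcons; case: h => [|a h]; first by rewrite /= expn0; case: b.
rewrite rcons_cons code_cons /= size_rcons.
have := code_lt (rcons h b); rewrite size_rcons.
move: (Defs.code _) (2 ^ _)%N => c P cP.
by case: a; rewrite ?mul1n ?mul0n ?add0n ?cP// ltnNge leq_addr /= addKn.
Qed.

End Code.

(** * The program and its correctness *)

Section Simulation.
Variables (R : realType) (n m k : nat) (G : sgraph n m).
Variables (M : memory_model R m k).
Implicit Types (past : seq {set 'I_m}) (A : {set 'I_n}) (S : {set 'I_m}).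

Lemma history_bits past (e : 'I_m) :
  history M past e =
  drop (size past) (map (fun X : {set 'I_m} => e \in X) (init M ++ past)) :>
    seq bool.
Proof.
have sz : size (drop (size past) (map (fun X : {set 'I_m} => e \in X) (init M
  ++ past))) = k.
  by rewrite size_drop size_map size_cat size_tuple addnK.
apply: (@eq_from_nth _ false); first by rewrite size_tuple sz.
move=> i; rewrite size_tuple => ik.
rewrite -[i]/(nat_of_ord (Ordinal ik)) -tnth_nth tnth_mktuple nth_drop /=.
by rewrite (nth_map finset.set0)// size_cat size_tuple addnC ltn_add2r.
Qed.

Lemma code_history_rcons past S (e : 'I_m) :
  let h := Defs.code (history M past e) in
  let c := (h + h + (e \in S))%N in
  Defs.code (history M (rcons past S) e) = if (c < 2 ^ k)%N then c else (c - 2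
    ^ k)%N.
Proof.
move=> h c; have := code_shift (history M past e) (e \in S).
rewrite size_tuple -/h -/c => <-; congr Defs.code; rewrite !history_bits
  -rcons_cat map_rcons size_rcons -drop1 -addn1 addnC -drop_drop.
by rewrite drop_rcons// size_map size_cat leq_addl.
Qed.

(** The cell is filled through a choice of a pair; codes are injective and below 2^k, so Euclidean
    division by 2^k shows that the pair is unique. *)
Lemma input_pr (s y : 'I_n) eps c (e : 'I_m) (h : k.-tuple bool) :
  rarr (input G M s y eps c) 1 (e * 2 ^ k + Defs.code h)%N = pr M e h.
Proof.
rewrite /=; case: pickP => [[e' h'] /= /eqP E|/(_ (e, h))]; last by rewrite
  eqxx.
have lth (g : k.-tuple bool) : (Defs.code g < 2 ^ k)%N.
  by rewrite -[X in (_ < 2 ^ X)%N](size_tuple g) code_lt.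
have K0 : (0 < 2 ^ k)%N by rewrite expn_gt0.
have Ee : e = e'.
  apply: val_inj; have := congr1 (divn^~ (2 ^ k)%N) E.
  by rewrite /= !divnMDl// !divn_small// !addn0.
congr (pr M _ _) => //; apply/val_inj/code_inj; first by rewrite !size_tuple.
by apply/eqP; move: E => /eqP; rewrite Ee eqn_add2l eq_sym.
Qed.

Lemma spread_set0 A : spread G A finset.set0 = A.
Proof.
apply/setP => v; rewrite !inE; case: (v \in A) => //=.
by apply/existsP => -[e]; rewrite !inE.
Qed.

Lemma edge_eqP e u v : edge G e = [set u; v]%SET ->
  (u = (ends G e).1 /\ v = (ends G e).2) \/ (u = (ends G e).2 /\ v = (ends G
    e).1).
Proof.
rewrite /edge; have := ends_neq G e; case: (ends G e) => a b /= ab /setP E.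
have := E u; have := E v; have := E a; have := E b; rewrite !inE !eqxx ?orbT /=.
move=> Eb Ea /orP[] /eqP Ev /orP[] /eqP Eu; subst; auto.
- by move: Eb; rewrite orbb eq_sym (negPf ab).
- by move: Ea; rewrite orbb (negPf ab).
Qed.

(** The new edge is tested against the fixed set [A], once in each direction; the two calls of
    [relax] do the same. *)
Lemma spreadU1 A S (e : 'I_m) v :
  (v \in spread G A (e |: S)%SET) =
  [|| v \in spread G A S, ((ends G e).1 \in A) && (v == (ends G e).2)
    | ((ends G e).2 \in A) && (v == (ends G e).1)].
Proof.
rewrite !inE; case: (v \in A) => //=; apply/existsP/idP => [[e']|].
  rewrite !inE => /andP[/orP[/eqP ->|e'S] /existsP[u /andP[uA /eqP E]]].
    by case: (edge_eqP E) uA => -[-> ->] ->; rewrite eqxx ?orbT.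
  apply/orP; left; apply/existsP; exists e'; rewrite e'S.
  by apply/existsP; exists u; rewrite uA E /=.
case/or3P => [/existsP[e' /andP[e'S H]]|/andP[uA /eqP->]|/andP[uA /eqP->]].
- by exists e'; rewrite !inE e'S orbT.
- by exists e; rewrite !inE eqxx; apply/existsP; exists (ends G e).1; rewrite
    uA /edge /=.
- exists e; rewrite !inE eqxx; apply/existsP; exists (ends G e).2.
  by rewrite uA /edge finset.setUC /=.
Qed.

End Simulation.

(* Working memory: natural array 5 holds the code of the current history of
   each edge, and natural array 6 the arrival time at each vertex in the current
   sample (N + 1 for the vertices not yet reached).  The cells of natural array
   7 are: 0, the number N; 1, the sum of the samples; 2, 3, 4 and 7, the loop
   counters for samples, time steps, edges and vertices; 5, the offset e * 2^k
   in the table of probabilities; 6, the last random bit; 8, the exponent of n.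
   Real array 3 holds 4 n^2 n^j / eps^2 in cell 0. *)
Definition clock : nexp := NAdd (var 3) (NConst 1).

(* With truncated subtraction, T - (T - x) is the minimum of T and x.  Vertices
   reached at the current time T do not pass the test, so that a journey uses
   at most one edge per time step. *)
Definition relax (a b : nat) : cmd :=
  let target := NGet b (var 4) in
  If (NLt (NGet 6 (NGet a (var 4))) clock)
     (NSet 6 target (NSub clock (NSub clock (NGet 6 target)))) Skip.

(** [h] is an expression, evaluated anew at each use: the test sees the doubled code, not the old
    one. *)
Definition record_step : cmd :=
  let h := NGet 5 (var 4) in
  Seq (NSet 5 (var 4) (NAdd (NAdd h h) (var 6)))
      (If (NLt h (NGet 0 (NConst 4))) Skip
          (NSet 5 (var 4) (NSub h (NGet 0 (NConst 4))))).

Definition spread_step : cmd :=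
  If (NLt (NConst 0) (var 6)) (Seq (relax 1 2) (relax 2 1)) Skip.

Definition edge_step : cmd :=
  Seq (Flip 7 (NConst 6) (RGet 1 (NAdd (var 5) (NGet 5 (var 4)))))
 (Seq record_step
 (Seq spread_step
      (set_var 5 (NAdd (var 5) (NGet 0 (NConst 4)))))).

Definition edge_loop : cmd := for_loop 4 (NGet 0 (NConst 1)) edge_step.

(** The sum grows by one for each step that begins with the target unreached, hence by min (X, N)
    per sample. *)
Definition time_step : cmd :=
  Seq (Seq (If (NLt (NGet 6 (NGet 0 (NConst 3))) clock) Skip (incr 1))
           (set_var 5 (NConst 0)))
      edge_loop.

Definition time_loop : cmd := for_loop 3 (var 0) time_step.

Definition sample_step : cmd :=
  Seq (for_loop 4 (NGet 0 (NConst 1)) (NSet 5 (var 4) (NGet 3 (var 4))))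
 (Seq (for_loop 7 (NGet 0 (NConst 0)) (NSet 6 (var 7) (NAdd (var 0) (NConst
   1))))
 (Seq (NSet 6 (NGet 0 (NConst 2)) (NConst 0))
      time_loop)).

Definition sample_loop : cmd := for_loop 2 (var 0) sample_step.

Definition scale_step : cmd :=
  Seq (RSet 3 (NConst 0) (RMul (RGet 3 (NConst 0)) (RNat (NGet 0 (NConst 0)))))
      (incr 8).

(** Expressions offer no rounding, so both ceilings are found by counting up. *)
Definition algorithm : cmd :=
  let z := RGet 3 (NConst 0) in
  let eps := RGet 0 (NConst 0) in
  let n := RNat (NGet 0 (NConst 0)) in
  Seq (RSet 3 (NConst 0) (RDiv (RMul (RNat (NConst 4)) (RMul n n)) (RMul eps
    eps)))
 (Seq (While (RLt (RNat (var 8)) (RGet 0 (NConst 1))) scale_step)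
 (Seq (While (RLt (RNat (var 0)) z) (incr 0))
 (Seq sample_loop
      (Seq (RSet 2 (NConst 0) (RDiv (RNat (var 1)) (RNat (var 0))))
           (If (RLt (RGet 2 (NConst 0)) (RNat (var 0))) Skip
               (NSet 4 (NConst 0) (NConst 1))))))).

Definition relaxed (arr : nat -> nat) (T u v i : nat) : nat :=
  if (arr u < T)%N && (i == v) then minn T (arr v) else arr i.

(** * Invariants of the loops *)

Section Correctness.
Variables (R : realType) (n m k : nat) (G : sgraph n m).
Variables (M : memory_model R m k) (s y : 'I_n) (eps c : R).
Implicit Types (past : seq {set 'I_m}) (A : {set 'I_n}) (S : {set 'I_m}).
Implicit Types (st : state R) (g : state R -> R -> Prop).

Lemma wp_relax a b g st x :
  (forall st', (forall a' i : nat, a' != 6%N -> narr st' a' i = narr st a' i) ->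
     rarr st' = rarr st ->
     (forall i, narr st' 6 i =
        relaxed (narr st 6) (narr st 7 3).+1 (narr st a (narr st 7 4))
          (narr st b (narr st 7 4)) i) -> g st' x) ->
  wp (relax a b) g st x.
Proof.
move=> H; rewrite /= addn1; case: ifP => lt; apply: H => //.
- by move=> a' i /negPf a6; rewrite /= /upd a6.
- move=> i; rewrite /= /upd /relaxed lt /=; case: eqP => // _.
  by rewrite /minn; case: ltnP; lia.
- by move=> i; rewrite /relaxed lt.
Qed.

Lemma wp_seq c1 c2 g st x : wp c1 (wp c2 g) st x -> wp (Seq c1 c2) g st x.
Proof. by []. Qed.

Lemma wp_record g st x :
  (forall st', (forall a i : nat, a != 5%N -> narr st' a i = narr st a i) ->
     rarr st' = rarr st ->
     (forall i, narr st' 5 i = if i == narr st 7 4 then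
         let h := narr st 5 i in let h' := (h + h + narr st 7 6)%N in
         if (h' < narr st 0 4)%N then h' else (h' - narr st 0 4)%N
       else narr st 5 i) -> g st' x) ->
  wp record_step g st x.
Proof.
move=> H; rewrite /= /upd /= eqxx; case: ifP => lt; apply: H => //.
- by move=> a i /negPf a5; rewrite /= /upd a5.
- by move=> i; rewrite /= /upd /=; case: eqP => // ->; rewrite lt.
- by move=> a i /negPf a5; rewrite /= /upd a5 /=.
- by move=> i; rewrite /= /upd /=; case: eqP => // ->; rewrite lt ?eqxx.
Qed.

Lemma wp_spread g st x :
  (forall st', (forall a i : nat, a != 6%N -> narr st' a i = narr st a i) ->
     rarr st' = rarr st ->
     (forall i, narr st' 6 i =
        let T := (narr st 7 3).+1 in
        let u := narr st 1 (narr st 7 4) in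
        let v := narr st 2 (narr st 7 4) in
        if (0 < narr st 7 6)%N then relaxed (relaxed (narr st 6) T u v) T v u i
        else narr st 6 i) -> g st' x) ->
  wp spread_step g st x.
Proof.
move=> H; have -> : wp spread_step g st x = if (0 < narr st 7 6)%N
  then wp (relax 1 2) (wp (relax 2 1) g) st x else g st x by [].
case lt: (0 < narr st 7 6)%N; last by apply: H => // i; rewrite lt.
apply: wp_relax => st1 e1 r1 a1; apply: wp_relax => st2 e2 r2 a2.
apply: H => [a i a6||i]; first by rewrite e2// e1.
  by rewrite r2.
rewrite lt a2 !e1//; rewrite /relaxed; rewrite !a1.
by case: ifP.
Qed.

Let st0 : state R := input G M s y eps c.

Definition base N l st : Prop :=
  [/\ forall a i, (a < 4)%N -> narr st a i = narr st0 a i,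
      narr st 4 0 = 0%N,
      forall a i, (a < 2)%N -> rarr st a i = rarr st0 a i &
      narr st 7 0 = N /\ narr st 7 2 = l].

Lemma base_eq N l st st' : base N l st ->
  (forall a i, (a < 5)%N -> narr st' a i = narr st a i) ->
  (forall a i, (a < 2)%N -> rarr st' a i = rarr st a i) ->
  narr st' 7 0 = narr st 7 0 -> narr st' 7 2 = narr st 7 2 -> base N l st'.
Proof.
move=> [b1 b2 b3 [b4 b5]] e1 e2 e3 e4; split.
- by move=> a i a4; rewrite e1 ?b1// ltnW.
- by rewrite e1.
- by move=> a i a2; rewrite e2 ?b3.
- by rewrite e3 e4.
Qed.

Lemma base_nset N l st a i v : base N l st -> (4 < a)%N ->
  (a != 7%N) || (i != 0%N) && (i != 2) ->
  base N l (nset st a i v).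
Proof.
move=> b a4 ai; apply: (base_eq b) => //= [a' i' a'5||]; rewrite /upd.
- by case: eqP => // E; subst; lia.
- by rewrite (eq_sym 7%N) (eq_sym 0%N); case: (a == 7%N) ai => //= /andP[/negPf
    ->].
- by rewrite (eq_sym 7%N) (eq_sym 2%N); case: (a == 7%N) ai => //= /andP[_
    /negPf ->].
Qed.

Lemma input_end1 (e : 'I_m) : narr st0 1 e = (ends G e).1.
Proof. by rewrite /= valK. Qed.

Lemma input_end2 (e : 'I_m) : narr st0 2 e = (ends G e).2.
Proof. by rewrite /= valK. Qed.

Lemma input_history (e : 'I_m) : narr st0 3 e = Defs.code (history M [::] e).
Proof. by rewrite /= valK. Qed.

(** The arrival array in the middle of a time step, [S] being the edges found present so far. The
    value N + 1 exceeds every clock value. *)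
Definition arrivals N past S st : Prop := forall v : 'I_n,
  let A := reached G s past in
  [/\ v \in A -> (narr st 6 v <= size past)%N,
      v \notin A -> v \in spread G A S -> narr st 6 v = (size past).+1 &
      v \notin spread G A S -> narr st 6 v = N.+1].

(** The last clause is a conditional expectation: the edges before j have the drawn bits as
    probabilities, the others keep their law. *)
Definition edge_inv N l past acc (H : seq {set 'I_m} -> R) j st x : Prop :=
  exists S, [/\ base N l st,
    [/\ narr st 7 1 = acc, narr st 7 3 = size past & narr st 7 5 = (j * 2 ^
      k)%N],
    forall e : 'I_m, narr st 5 e =
      Defs.code (history M (if (e < j)%N then rcons past S else past) e),
    arrivals N past S st /\ (forall e : 'I_m, e \in S -> (e < j)%N) &
    x = subset_expect (fun e : 'I_m => if (e < j)%N then (e \in S)%:R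
                                     else next_prob M past e)
                      (fun S' => H (rcons past S'))].

(** A stored time is below the clock exactly on the old reached set, so updates made during this
    step enable no further ones. *)
Lemma arrivals_step N past S st st' (e : 'I_m) (b : bool) :
  (size past < N)%N -> arrivals N past S st ->
  (forall i, narr st' 6 i =
    if b then
      relaxed (relaxed (narr st 6) (size past).+1 (ends G e).1 (ends G e).2)
        (size past).+1 (ends G e).2 (ends G e).1 i
    else narr st 6 i) ->
  arrivals N past (if b then e |: S else S)%SET st'.
Proof.
move=> tN ok; case: b => E; last by move=> v; rewrite !E; exact: ok.
have ok_lt (v : 'I_n) : (narr st 6 v < (size past).+1)%N = (v \in reached G s
  past).
  have [ok1 ok2 ok3] := ok v; case vA: (v \in _); first by rewrite ltnS ok1.
  case vS: (v \in spread G (reached G s past) S).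
    by rewrite ok2 ?vA// ltnn.
  by rewrite ok3 ?vS//; lia.
have ok_spread (v : 'I_n) : (narr st 6 v <= (size past).+1)%N =
    (v \in spread G (reached G s past) S).
  have [ok1 ok2 ok3] := ok v; case vS: (v \in spread _ _ _).
    case vA: (v \in reached G s past); first by rewrite leqW ?ok1.
    by rewrite ok2 ?vA ?leqnn.
  by rewrite ok3 ?vS//; lia.
move=> v A; have [ok1 ok2 ok3] := ok v.
have Asub u : u \in A -> u \in spread G A S by exact: (fintype.subsetP
  (sub_spread _ _ _)).
have := ends_neq G e; rewrite spreadU1 E; move: (ends G e).1 (ends G e).2 => a
  b ab.
have abn : (a == b :> nat) = false by apply/negbTE.
rewrite /relaxed !ok_lt -/A eqxx abn andbF !andbT.
(* The second relaxation may read a cell just rewritten by the first; a minimum with the clock does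
   not change the test. *)
have mb : (minn (size past).+1 (narr st 6 b) < (size past).+1)%N = (b \in A).
  by rewrite gtn_min ltnn ok_lt.
have -> : ((if a \in A then minn (size past).+1 (narr st 6 b) else narr st 6 b)
  <
    (size past).+1)%N = (b \in A) by case: ifP => _; rewrite ?mb ?ok_lt.
have vabE (w : 'I_n) : (v == w :> nat) = (v == w) by [].
rewrite !vabE; have ok_min : forall u : 'I_n,
    u \in A -> minn (size past).+1 (narr st 6 u) = narr st 6 u.
  by move=> u uA; apply/minn_idPr; rewrite ltnW// ok_lt.
case vA: (v \in A) (ok1) => /= ok1'.
  rewrite (Asub _ vA)/=; split => // _.
  have l := ok1' isT.
  case: ifP => [/andP[_ /eqP E2]|_]; first by subst v; rewrite geq_min l orbT.
  case: ifP => [/andP[_ /eqP E2]|_] //; by subst v; rewrite geq_min l orbT.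
split => //.
  move=> _ /or3P[vS|/andP[aA /eqP E2]|/andP[bA /eqP E2]].
  - have l := ok2 (negbT vA) vS.
    case: ifP => [/andP[_ /eqP E2]|_]; first by subst v; rewrite l minnn.
    by case: ifP => [/andP[_ /eqP E2]|_] //; subst v; rewrite l minnn.
  - subst v; rewrite [b == a]eq_sym (negPf ab) andbF aA eqxx /=.
    apply/minn_idPl; case bS: (b \in spread G A S); last by rewrite ok3 ?bS//;
      lia.
    by rewrite ok2 ?vA.
  - subst v; rewrite bA eqxx /=.
    apply/minn_idPl; case aS: (a \in spread G A S); last by rewrite ok3 ?aS//;
      lia.
    by rewrite ok2 ?vA.
by rewrite !negb_or => /and3P[vS /negPf -> /negPf ->]; rewrite ok3.
Qed.

Lemma edge_step_ensures N l past acc H j : (size past < N)%N -> (j < m)%N ->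
  ensures (cost edge_step) edge_step
    (fun st x => narr st 7 4 = j /\ edge_inv N l past acc H j st x)
    (fun st x => narr st 7 4 = j /\ edge_inv N l past acc H j.+1 st x).
Proof.
move=> tN jm; apply: ensures_straight => // st x [st4 [S [bs [st1 st3 st5] hist
  [arr Sj] ->]]].
pose e := Ordinal jm; have [bs1 bs2 bs3 _] := bs.
have K : narr st 0 4 = (2 ^ k)%N by rewrite bs1.
have hist_e : narr st 5 j = Defs.code (history M past e) by rewrite (hist e) /=
  ltnn.
have biasE : reval st (RGet 1 (NAdd (var 5) (NGet 5 (var 4)))) = next_prob M
  past e.
  by rewrite /= st4 st5 hist_e bs3// (input_pr G M s y eps c e).
have eS : e \notin S by apply/negP => /Sj; rewrite /= ltnn.
pose S' (b : bool) := (if b then e |: S else S)%SET.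
have memS' b (e' : 'I_m) : (e' \in S' b) = if e' == e then b else e' \in S.
  rewrite /S'; case: b; rewrite ?inE; case: eqP => //= ->; exact/negbTE.
pose p b := set_prob (fun e : 'I_m => if (e < j)%N then (e \in S)%:R
                      else next_prob M past e) e b.
have pE (b : bool) : p b%:R =1 fun e' : 'I_m =>
    if (e' < j.+1)%N then (e' \in S' b)%:R else next_prob M past e'.
  move=> e'; rewrite /p /set_prob memS' ltnS [(e' <= j)%N]leq_eqVlt.
  by rewrite -[X in X || _]/(e' == e); case: eqP.
split; first by rewrite biasE; exact: next_prob01.
(* The expectations given that [e] is present, respectively absent. *)
exists (subset_expect (p 1) (fun S' => H (rcons past S'))),
       (subset_expect (p 0) (fun S' => H (rcons past S'))).
have post (b : bool) : wp (Seq record_step (Seq spread_step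
      (set_var 5 (NAdd (var 5) (NGet 0 (NConst 4))))))
    (fun st x => narr st 7 4 = j /\ edge_inv N l past acc H j.+1 st x)
    (nset st 7 6 b) (subset_expect (p b%:R) (fun S' => H (rcons past S'))).
  apply: wp_seq; apply: wp_record => st' e1 r1 h1.
  apply: wp_seq; apply: wp_spread => st'' e2 r2 a2.
  have E a i : (a != 5)%N -> (a != 6)%N -> ~~ ((a == 7) && (i == 6))%N ->
      narr st'' a i = narr st a i.
    move=> a5 a6 /negPf a7.
    by rewrite e2// e1// /= /upd a7.
  have base2 : base N l st''.
    apply: (base_eq bs) => [a i a5|a i a1||]; try by rewrite E.
      by rewrite E//; lia.
    by rewrite r2 r1.
  split; first by rewrite /= /upd /= E.
  exists (S' b); split.
  - exact: base_nset.
  - rewrite /= /upd /= !E//; split=> //.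
    by rewrite st5 K mulSn addnC.
  - move=> e'; set rhs := Defs.code _; rewrite /= /upd /= e2// h1 /= /upd /=
      st4.
    rewrite K !hist /rhs ltnS [(e' <= j)%N]leq_eqVlt -[X in X || _]/(e' == e).
    have cS (T1 T2 : {set 'I_m}) : (e' \in T1) = (e' \in T2) ->
        Defs.code (history M (rcons past T1) e') =
        Defs.code (history M (rcons past T2) e').
      by move=> eT; rewrite !code_history_rcons eT.
    rewrite -[X in if X then _ else _]/(e' == e); case: eqP => [Ee|/eqP/negPf
      ne] /=.
      by rewrite Ee ltnn code_history_rcons memS' eqxx.
    by case: ltnP => // _; apply: cS; rewrite memS' ne.
  - split.
      apply: (@arrivals_step N past S st _ e b) => // i.
      have e1E : narr st 1 j = (ends G e).1 by rewrite bs1// (input_end1 e).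
      have e2E : narr st 2 j = (ends G e).2 by rewrite bs1// (input_end2 e).
      rewrite /= /upd /= a2 /= !e1//= /upd /= st3 st4 e1E e2E.
      by case: (b); rewrite //= /relaxed !e1.
    move=> e'; rewrite memS'; case: eqP => [-> _|_ /Sj]; first exact: ltnSn.
    by move/ltnW.
  - exact: eq_subset_expect (pE b) _.
split; [|exact: (post true)|exact: (post false)].
by rewrite biasE (subset_expect_split _ e) /= ltnn.
Qed.

Lemma edge_inv_var N l past acc H j st x v :
  edge_inv N l past acc H j st x -> edge_inv N l past acc H j (nset st 7 4 v) x.
Proof.
by move=> [S [bs ? ? ? ?]]; exists S; split=> //; exact: base_nset.
Qed.

Lemma base_input N l st : base N l st ->
  [/\ narr st 0 0 = n, narr st 0 1 = m, narr st 0 2 = s, narr st 0 3 = y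
    & narr st 0 4 = (2 ^ k)%N].
Proof. by case=> b _ _ _; rewrite !b. Qed.

Definition for_cost (J b : nat) : nat := (J * b.+3).+3.

Lemma edge_loop_ensures N l past acc H : (size past < N)%N ->
  ensures (for_cost m (cost edge_step)) edge_loop
    (edge_inv N l past acc H 0) (edge_inv N l past acc H m).
Proof.
move=> tN; apply: ensures_for => [j v st x _|j st x _ [S [/base_input[]]]|j jm]
  //.
  exact: edge_inv_var.
exact: edge_step_ensures.
Qed.

Definition time_inv N l past acc st : Prop :=
  [/\ base N l st, narr st 7 1 = acc,
      forall e : 'I_m, narr st 5 e = Defs.code (history M past e) &
      forall v : 'I_n, let A := reached G s past in
        (v \in A -> (narr st 6 v <= size past)%N) /\
        (v \notin A -> narr st 6 v = N.+1)].

(** The simulated past depends on the coin flips, hence the existential; the bound is the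
    expectation of [F] given that past. *)
Definition time_pre N l F j st x : Prop := exists past acc,
  [/\ size past = j, time_inv N l past acc st
    & x = run_expect G M s y (N - j) past acc F].

Definition time_cost : nat := (4 + for_cost m (cost edge_step)).+1.

Lemma time_step_ensures N l F j : (j < N)%N ->
  ensures time_cost time_step
    (fun st x => narr st 7 3 = j /\ time_pre N l F j st x)
    (fun st x => narr st 7 3 = j /\ time_pre N l F j.+1 st x).
Proof.
move=> jN N0 K Q HN st x [st3 [past [acc [szp tinv xE]]]].
pose acc' := (acc + missed G s y past)%N.
pose H past' := run_expect G M s y (N - j.+1) past' acc' F.
have tN : (size past < N)%N by rewrite szp.
(* The past is now a parameter, so the intermediate assertion may mention it. *)
suff ens : ensures time_cost time_step
    (fun st x => [/\ narr st 7 3 = j, time_inv N l past acc st &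
                   x = run_expect G M s y (N - j) past acc F])
    (fun st x => narr st 7 3 = j /\ time_pre N l F j.+1 st x).
  exact: ens HN _ _ _.
apply: (ensures_seq (h := edge_inv N l past acc' H 0)); last first.
  apply: ensures_weaken (@edge_loop_ensures N l past acc' H tN) => // st' x'.
  move=> [S [bs [st1' st3' _] hist [arr _] ->]]; split; first by rewrite st3'
    szp.
  exists (rcons past S), acc'; split; first by rewrite size_rcons szp.
    split=> // [e|v /=]; first by rewrite hist ltn_ord.
    have [ok1 ok2 ok3] := arr v; rewrite reached_rcons size_rcons; split=> //
      vS.
    by case vA: (v \in reached G s past); [rewrite leqW ?ok1 | rewrite ok2 ?vA].
  (* All edges are drawn, and the conditional law is concentrated on [S]. *)
  rewrite -[RHS]/(H (rcons past S)) -(subset_expect_det S (fun S' => H (rcons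
    past S'))).
  by apply: eq_subset_expect => // e; rewrite ltn_ord.
apply: ensures_straight => // st' x' [st3' [bs st1' hist arr] ->].
have [i0 i1 i2 i3 i4] := base_input bs.
have lt_y : (narr st' 6 y < j.+1)%N = ~~ missed G s y past.
  have [ok1 ok2] := arr y; rewrite /missed negbK.
  by case yA: (y \in _); [rewrite ltnS -szp ok1 | rewrite ok2 ?yA//; lia].
have post st'' : (forall a i, (a < 7)%N -> narr st'' a i = narr st' a i) ->
    (forall a i, rarr st'' a i = rarr st' a i) -> narr st'' 7 0 = narr st' 7 0
      ->
    narr st'' 7 2 = narr st' 7 2 ->
    narr st'' 7 1 = acc' -> narr st'' 7 3 = j -> narr st'' 7 5 = 0%N ->
    edge_inv N l past acc' H 0 st'' (run_expect G M s y (N - j) past acc F).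
  move=> eN eR e0 e2 e1 e3 e5; exists finset.set0; split.
  - by apply: (base_eq bs) => // a i a5; rewrite eN//; lia.
  - by rewrite szp e5 mul0n.
  - by move=> e; rewrite eN.
  - split=> [v A|e]; last by rewrite inE.
    rewrite spread_set0 eN//; have [ok1 ok2] := arr v.
    by split=> // /negPf ->.
  - rewrite -(subnSK jN) /= /next_expect.
    by apply: eq_subset_expect.
rewrite /= i3 st3' addn1 lt_y; case ms: (missed G s y past) => /=.
- apply: post => //= [a i a7|]; first by rewrite /upd (ltn_eqF a7).
  by rewrite /upd /= st1' /acc' ms.
- apply: post => //= [a i a7|]; first by rewrite /upd (ltn_eqF a7).
  by rewrite /upd /= st1' /acc' ms addn0.
Qed.

Lemma time_inv_var N l past acc st i v : i != 0%N -> i != 1%N -> i != 2 ->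
  time_inv N l past acc st -> time_inv N l past acc (nset st 7 i v).
Proof.
move=> i0 i1 i2 [bs st1 hist arr]; split=> //.
  by apply: base_nset; rewrite ?i0 ?i2.
by rewrite /= /upd /= eq_sym (negPf i1).
Qed.

Lemma time_loop_ensures N l F :
  ensures (for_cost N time_cost) time_loop (time_pre N l F 0) (time_pre N l F
    N).
Proof.
apply: ensures_for => [j v st x _ [past [acc [szp tinv xE]]]|
  j st x _ [past [acc [_ [[_ _ _ [bN _]] _ _ _] _]]]|j jN] //.
  by exists past, acc; split=> //; apply: time_inv_var.
exact: time_step_ensures.
Qed.

(** [base] records the sample counter, which [ensures_for] wants ignored; hence [l] is left free. *)
Definition sample_pre N F j st x : Prop := exists l acc,
  [/\ base N l st, narr st 7 1 = acc & x = samples_expect G M s y N (N - j) acc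
    F].

Definition sample_cost N : nat :=
  (for_cost m 1 + (for_cost n 1 + (1 + for_cost N time_cost).+1).+1).+1.

Lemma sample_step_ensures N F j : (j < N)%N ->
  ensures (sample_cost N) sample_step
    (fun st x => narr st 7 2 = j /\ sample_pre N F j st x)
    (fun st x => narr st 7 2 = j /\ sample_pre N F j.+1 st x).
Proof.
move=> jN N0 K Q HN st x [st2 [l [acc [bs st1 xE]]]].
have lj : l = j by case: bs => _ _ _ [_ <-].
pose x0 := samples_expect G M s y N (N - j) acc F.
pose F' a := samples_expect G M s y N (N - j.+1) a F.
pose pre i (st : state R) := [/\ base N j st, narr st 7 1 = acc &
  forall e : 'I_m, (e < i)%N -> narr st 5 e = Defs.code (history M [::] e)].
suff ens : ensures (sample_cost N) sample_step
    (fun st x => pre 0%N st /\ x = x0)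
    (fun st x => narr st 7 2 = j /\ sample_pre N F j.+1 st x).
  by apply: ens HN _ _ _; split=> //; split=> //; rewrite -lj.
pose pre' i st := pre m st /\
  forall v : 'I_n, (v < i)%N -> narr st 6 v = N.+1.
apply: (ensures_seq (h := fun st x => pre m st /\ x = x0)).
  apply: (ensures_for (f := fun i st x => pre i st /\ x = x0)).
  - by move=> i v st' x' _ [[bs' ? ?] ?]; split=> //; split=> //; exact:
      base_nset.
  - by move=> i st' x' _ [[/base_input[]]].
  - move=> i im; apply: ensures_straight => // st' x' [st4 [[bs' a1 hist] ->]].
    rewrite /= st4; split=> //; split=> //; split=> //; first exact: base_nset.
    move=> e; rewrite ltnS leq_eqVlt /= /upd /= => /orP[/eqP ei|ei].
      by rewrite ei eqxx -ei -input_history; have [b1 _ _ _] := bs'; rewrite b1.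
    by rewrite (ltn_eqF ei) hist.
apply: (ensures_seq (h := fun st x => pre' n st /\ x = x0)).
  apply: (@ensures_weaken _ (for_cost n 1) _ _
      (fun st x => pre' 0%N st /\ x = x0) _ (fun st x => pre' n st /\ x = x0))
        => //.
    by move=> st' x' [].
  apply: (ensures_for (f := fun i st x => pre' i st /\ x = x0)).
  - move=> i v st' x' _ [[[bs' ? ?] ?] ?]; split=> //; split=> //.
    by split=> //; exact: base_nset.
  - by move=> i st' x' _ [[[/base_input[]]]].
  - move=> i im; apply: ensures_straight => // st' x' [st7 [[[bs' a1 hist] arr]
      ->]].
    rewrite /= st7 addn1; split=> //; split=> //; split=> //.
      by split=> //; exact: base_nset.
    have b0 : narr st' 7 0 = N by case: bs' => _ _ _ [].
    move=> v; rewrite ltnS leq_eqVlt /= /upd /= => /orP[/eqP ei|ei].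
      by rewrite ei eqxx b0.
    by rewrite (ltn_eqF ei) arr.
apply: (ensures_seq (h := time_pre N j F' 0)).
  apply: ensures_straight => // st' x' [[[bs' a1 hist] arr] ->] /=.
  have [_ _ i2 _ _] := base_input bs'.
  exists [::], acc; split=> //; last by rewrite subn0 /x0 -(subnSK jN).
  split=> //; first exact: base_nset.
    by move=> e; rewrite /= /upd /= hist.
  move=> v /=; rewrite /upd /= i2 /reached /= inE -[X in if X then _ else _]/(v
    == s).
  by case: eqP => // _; split=> // _; rewrite arr.
apply: ensures_weaken (@time_loop_ensures N j F') => // st' x'.
move=> [past [acc' [_ [bs' a1 _ _] ->]]]; split; first by case: bs' => _ _ _ [].
by exists j, acc'; split=> //; rewrite subnn.
Qed.

Lemma base_set_sample N l v st : base N l st -> base N v (nset st 7 2 v).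
Proof.
case=> b1 b2 b3 [b4 _]; split=> // a i a4.
by rewrite /= /upd (ltn_eqF (ltn_trans a4 _)) ?b1.
Qed.

Lemma sample_loop_ensures N F :
  ensures (for_cost N (sample_cost N)) sample_loop
    (sample_pre N F 0) (sample_pre N F N).
Proof.
apply: ensures_for => [j v st x _ [l [acc [bs st1 xE]]]|
  j st x _ [l [acc [[_ _ _ [bN _]] _ _]]]|j jN] //.
  by exists v, acc; split=> //; apply: base_set_sample bs.
exact: sample_step_ensures.
Qed.

Definition total_cost J N : nat :=
  (1 + ((J * (cost scale_step).+1).+1 + ((N * 2).+1 +
    (for_cost N (sample_cost N) + 4).+1).+1).+1).+1.

(** The hypotheses on [J] and [N] say that the two counting loops stop there; [F a] bounds the
    success once the samples sum to [a]. *)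
Lemma algorithm_ensures J N F (Q : pred (state R)) :
  let z := 4 * (n%:R * n%:R) / (eps * eps) in
  (forall j, (j <= J)%N -> (j%:R < c) = (j < J)%N) ->
  (forall i, (i <= N)%N -> (i%:R < z * n%:R ^+ J) = (i < N)%N) ->
  (forall st (a : nat),
     output st = (if a%:R / N%:R < N%:R :> R then (a%:R / N%:R)%:E else +oo%E)
       ->
     F a <= (Q st)%:R) ->
  samples_expect G M s y N N 0 F <= prob (total_cost J N) [:: algorithm] st0 Q.
Proof.
move=> z Jc Nz FQ; set x0 := samples_expect _ _ _ _ _ _ _ _.
pose final (st : state R) x := exists a : nat,
  output st = (if a%:R / N%:R < N%:R :> R then (a%:R / N%:R)%:E else +oo%E) /\
  x = F a.
suff ens : ensures (total_cost J N) algorithm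
    (fun st x => st = st0 /\ x = x0) final.
  rewrite -[total_cost J N]addn0; apply: (ens 0%N [::] Q) => // st x [a [ao
    ->]].
  exact: FQ.
pose pre N' z' (st : state R) x := [/\ base N' 0 st, narr st 7 1 = 0%N,
  rarr st 3 0 = z' & x = x0].
apply: (ensures_seq (h := fun st x => narr st 7 8 = 0%N /\ pre 0%N (z * n%:R ^+
  0) st x)).
  apply: ensures_straight => // _ x [-> ->] /=; split=> //.
  split=> //; last by rewrite /= /upd /= expr0 mulr1.
  by split=> // a i a2; rewrite /= /upd (ltn_eqF (ltn_trans a2 _)).
pose scaled j (st : state R) x := narr st 7 8 = j /\ pre 0%N (z * n%:R ^+ j) st
  x.
apply: (ensures_seq (h := pre 0%N (z * n%:R ^+ J))).
  apply: (@ensures_weaken _ (J * (cost scale_step).+1).+1 _ _ (scaled 0%N) _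
    (scaled J)) => //.
    by move=> st x [].
  apply: ensures_while => [j jJ|j st x jJ [st8 [[_ _ r01 _] _ _ _]]].
    apply: ensures_straight => // st x [st8 [bs a1 r3 ->]].
    have [i0 _ _ _ _] := base_input bs.
    split; first by rewrite /= /upd /= st8 addn1.
    split=> //; last by rewrite /= /upd /= r3 i0 exprSr mulrA.
    apply: base_nset => //; apply: (base_eq bs) => // a i a2.
    by rewrite /= /upd (ltn_eqF (ltn_trans a2 _)).
  by rewrite /= st8 r01//= Jc.
pose counted i := pre i (z * n%:R ^+ J).
apply: (ensures_seq (h := counted N)).
  apply: (@ensures_weaken _ (N * 2).+1 _ _ (counted 0%N) _ (counted N)) => //.
  apply: ensures_while => [i iN|i st x iN [[_ _ _ [b0 _]] _ r3 _]].
    apply: ensures_straight => // st x [[b1 b2 b3 [b4 b5]] a1 r3 ->].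
    split=> //; split=> // [a i' a4|]; last by rewrite /= /upd /= b4 addn1.
    by rewrite -b1//= /upd (ltn_eqF (ltn_trans a4 _)).
  by rewrite /= r3 b0 Nz.
apply: (ensures_seq (h := sample_pre N F N)).
  apply: ensures_weaken (@sample_loop_ensures N F) => // st x [bs a1 _ ->].
  by exists 0%N, 0%N; rewrite subn0.
apply: ensures_straight => // st x [l [acc [[_ b40 _ [b0 _]] a1 ->]]].
have out st' : narr st' 4 0 = (if acc%:R / N%:R < N%:R :> R then 0%N else 1%N)
  ->
    rarr st' 2 0 = acc%:R / N%:R ->
    final st' (samples_expect G M s y N (N - N) acc F).
  move=> e4 e2; exists acc; rewrite subnn /output e4 e2; split=> //.
  by case: (_ < _).
by rewrite /= /upd /= a1 b0; case: ifP => lt; apply: out; rewrite /= /upd /=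
  ?b40 ?lt ?a1 ?b0.
Qed.
End Correctness.

(** * Journeys and the law of the arrival time *)

Section Journeys.
Variables (n m : nat) (G : sgraph n m) (s : 'I_n).

(** Take the first edge along which the walk leaves [A]. *)
Lemma crossing_edge u es vs y (A : {set 'I_n}) :
  walk G u es vs -> last u vs = y -> u \in A -> y \notin A ->
  exists e a b, [/\ a \in A, b \notin A & edge G e = [set a; b]%SET].
Proof.
elim: es u vs => [|e es IH] u [|v vs] //= => [_ <- -> //|/andP[/eqP E w]] l uA
  yA.
case vA: (v \in A); first exact: IH w l vA yA.
by exists e, u, v; rewrite vA.
Qed.

Variable E : nat -> {set 'I_m}.

Definition upto (t : nat) : seq {set 'I_m} := [seq E i | i <- iota 1 t].

Lemma uptoS t : upto t.+1 = rcons (upto t) (E t.+1).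
Proof. by rewrite /upto -(addn1 t) iotaD map_cat cats1 add1n addn1. Qed.

Lemma reached_mono t t' : (t <= t')%N ->
  reached G s (upto t) \subset reached G s (upto t').
Proof.
move=> /subnK <-; elim: (t' - t)%N => [//|i IH].
by rewrite addSn uptoS reached_rcons (fintype.subset_trans IH)// sub_spread.
Qed.

Lemma walk_reached u t0 j vs : u \in reached G s (upto t0) ->
  all (fun et : 'I_m * nat => et.1 \in E et.2) j ->
  walk G u (unzip1 j) vs -> path ltn t0 (unzip2 j) ->
  last u vs \in reached G s (upto (last t0 (unzip2 j))).
Proof.
elim: j u t0 vs => [|[e t] j IH] u t0 [|v vs] //= uR /andP[eE jE].
move=> /andP[/eqP Ee w] /andP[tt p]; apply: IH => //.
case: t tt eE {p} => // t tt eE; rewrite uptoS reached_rcons !inE.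
apply/orP; right; apply/existsP; exists e; rewrite eE /=.
apply/existsP; exists u; rewrite Ee eqxx andbT.
exact: (fintype.subsetP (reached_mono _)) uR.
Qed.

Lemma journey_reached v j :
  journey G E s v j -> v \in reached G s (upto (arrival j)).
Proof.
move=> [jE [vs [w _ <-]] p]; apply: walk_reached => //.
by rewrite /reached /= inE.
Qed.

Lemma walk_rcons u es vs e v :
  walk G u es vs -> edge G e = [set last u vs; v]%SET ->
  walk G u (rcons es e) (rcons vs v).
Proof.
elim: es u vs => [|e' es IH] u [|v' vs] //=; first by move=> _ ->; rewrite eqxx.
by move=> /andP[-> w] Ee; apply: IH.
Qed.

(* Keeping the journey inside the set reached so far makes its vertices
   distinct: the vertex reached last is new. *)
Lemma reached_walk t v : v \in reached G s (upto t) -> exists j vs,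
  [/\ all (fun et : 'I_m * nat => et.1 \in E et.2) j,
      walk G s (unzip1 j) vs /\ uniq (s :: vs), last s vs = v,
      path ltn 0%N (unzip2 j) /\ (arrival j <= t)%N
    & {subset s :: vs <= reached G s (upto t)}].
Proof.
elim: t v => [|t IH] v.
  rewrite /reached /= inE => /eqP ->; exists [::], [::]; split=> // u.
  by rewrite !inE.
have mono := fintype.subsetP (reached_mono (leqnSn t)).
have [vt _|vt] := boolP (v \in reached G s (upto t)).
  have [j [vs [h1 h2 h3 [h4 h5] h6]]] := IH v vt.
  by exists j, vs; split=> // [|u /h6 /mono]; rewrite // leqW.
rewrite uptoS reached_rcons !inE (negPf vt) /=.
case/existsP => e /andP[eE /existsP[u /andP[/IH[j [vs [h1 [h2 h3] h4 [h5 h6]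
  h7]]] /eqP Ee]]].
exists (rcons j (e, t.+1)), (rcons vs v).
have vR : v \in reached G s (upto t.+1).
  rewrite uptoS reached_rcons !inE; apply/orP; right; apply/existsP; exists e.
  rewrite eE; apply/existsP; exists u; rewrite -h4 h7 ?mem_last//.
  by rewrite h4 Ee /=.
split.
- by rewrite all_rcons /= eE.
- rewrite /unzip1 map_rcons; split; first by apply: walk_rcons; rewrite // h4.
  rewrite -[_ && _]/(uniq (rcons (s :: vs) v)) rcons_uniq h3 andbT.
  by apply: contra vt; apply: h7.
- by rewrite last_rcons.
- rewrite /arrival /unzip2 map_rcons rcons_path last_rcons /=; split=> //.
  by rewrite h5 ltnS.
- rewrite -reached_rcons -uptoS => w; rewrite -rcons_cons mem_rcons inE.
  by case/orP=> [/eqP -> //|/h7 /mono].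
Qed.

Lemma reached_journey t v : v \in reached G s (upto t) ->
  exists2 j, journey G E s v j & (arrival j <= t)%N.
Proof.
move=> /reached_walk[j [vs [h1 [h2 h3] h4 [h5 h6] _]]]; exists j => //.
by split=> //; exists vs.
Qed.

(** X counts the times t >= 0 with X > t; without a journey both sides are infinite. *)
Lemma min_arrival_series (R : realType) y : s != y ->
  min_arrival R G E s y = (\sum_(0 <= t <oo) (missed G s y (upto t))%:R%:E)%E.
Proof.
move=> sy; set f := fun t : nat => ((missed G s y (upto t))%:R%:E : \bar R)%E.
have f0 t : (0 <= t)%N -> (0 <= f t)%E by rewrite lee_fin ler0n.
have [ex|never] := pselect (exists t, ~~ missed G s y (upto t)).
  have [t1 t1R t1min] := ex_minnP ex.
  have reachedP t : (t1 <= t)%N = ~~ missed G s y (upto t).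
    apply/idP/idP => [le|]; last exact: t1min.
    rewrite /missed negbK; apply: (fintype.subsetP (reached_mono le)).
    by move: t1R; rewrite /missed negbK.
  rewrite (nneseries_split 0 t1)// add0n eseries0 => [|t le _]; last first.
    by move: le; rewrite reachedP /f => /negPf ->.
  rewrite adde0 (eq_big_nat _ _ (F2 := fun=> 1%E)) => [|t /andP[_ lt]]; last
    first.
    by rewrite /f -[missed _ _ _ _]negbK -reachedP -ltnNge lt.
  rewrite sumEFin big_const_nat subn0 iter_addr_0.
  move: t1R; rewrite /missed negbK => /reached_journey[j jy jt].
  apply/eqP; rewrite eq_le; apply/andP; split.
    apply: ge_ereal_inf; exists ((arrival j)%:R)%:E; first by exists j.
    by rewrite lee_fin ler_nat.
  apply: le_ereal_inf_tmp => _ [j' jy' <-]; rewrite lee_fin ler_nat reachedP.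
  by rewrite /missed negbK; apply: journey_reached.
have miss t : missed G s y (upto t).
  by case: (boolP (missed G s y (upto t))) => // h; case: never; exists t.
rewrite /min_arrival [X in ereal_inf X](_ : _ = set0); last first.
  apply/seteqP; split => // x [j /journey_reached jy _].
  by move: (miss (arrival j)); rewrite /missed jy.
rewrite ereal_inf0; apply/esym/eqyP => r r0.
apply: le_trans (nneseries_lim_ge (Num.truncn r).+1 _) => //.
rewrite (eq_bigr (fun=> 1%E)) => [|t _]; last by rewrite /f miss.
rewrite sumEFin big_const_nat subn0 iter_addr_0 lee_fin ltW//.
by rewrite truncnS_gt.
Qed.

End Journeys.

(** * The expected arrival time as a series of tails *)

Section Law.
Variables (R : realType) (n m k : nat) (G : sgraph n m).
Variables (M : memory_model R m k) (s y : 'I_n).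
Variables (d : measure_display) (T : measurableType d) (P : probability T R).
Variable Gs : nat -> T -> {set 'I_m}.
Hypothesis gov : governed_by P M Gs.
Local Open Scope classical_set_scope.

Lemma snapshotsS t w :
  snapshots Gs t.+1 w = rcons (snapshots Gs t w) (Gs t.+1 w).
Proof. exact: (uptoS (Gs ^~ w)). Qed.

Lemma measurable_snapshots past :
  measurable [set w | snapshots Gs (size past) w = past].
Proof.
elim/last_ind: past => [|past S IH]; first by rewrite [X in measurable X](_ : _
  = setT)//; apply/seteqP.
rewrite [X in measurable X](_ : _ = [set w | snapshots Gs (size past) w = past]
  `&`
  [set w | Gs (size past).+1 w = S]).
  by apply: measurableI => //; apply: gov.1.
apply/seteqP; split => w /=; rewrite size_rcons snapshotsS.
  by move=> /rcons_inj[].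
by move=> [-> ->].
Qed.

Let late past i : set T :=
  [set w | snapshots Gs (size past) w = past /\
           missed G s y (snapshots Gs (size past + i) w)].

(** Splitting along the next snapshot turns [governed_by] into the recursion of [tail]; the
    probability of the past stays as a factor, since it may vanish. *)
Lemma late_prob i past : measurable (late past i) /\
  P (late past i) = (P [set w | snapshots Gs (size past) w = past] *
                     (tail G M s y i past)%:E)%E.
Proof.
elim: i past => [|i IH] past.
  rewrite /late addn0 /=; case ms: (missed G s y past).
    rewrite mule1 (_ : [set w | _] = [set w | snapshots Gs (size past) w =
      past]).
      by split=> //; exact: measurable_snapshots.
    by apply/seteqP; split => w /= => [[]//|E]; rewrite E.
  rewrite mule0 (_ : [set w | _] = set0) ?measure0//.
  by apply/seteqP; split => w //= -[->]; rewrite ms.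
have lateU : late past i.+1 = \bigcup_(S in [set: {set 'I_m}]) late (rcons past
  S) i.
  apply/seteqP; split => w /=.
    move=> [E ms]; exists (Gs (size past).+1 w) => //.
    by rewrite /late /= size_rcons addSnnS snapshotsS E.
  move=> [S _]; rewrite /late /= size_rcons addSnnS snapshotsS.
  by move=> [/rcons_inj[E _] ms]; split.
have fin : finite_set [set: {set 'I_m}] by exact: finite_finset.
rewrite lateU; split.
  by apply: fin_bigcup_measurable => // S _; apply: (IH _).1.
rewrite measure_fin_bigcup//; first last.
- by move=> S _; apply: (IH _).1.
- move=> S S' _ _ [w [[/= E _] [/= E' _]]]; move: E E'; rewrite !size_rcons =>
    ->.
  by move=> /rcons_inj[->].
rewrite (fsbigE (index_enum {set 'I_m}))//; last 2 first.
- exact: index_enum_uniq.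
- by move=> S _; rewrite mem_index_enum.
rewrite (eq_bigl xpredT) => [|S]; last by rewrite in_setT.
rewrite /next_expect /subset_expect -sumEFin ge0_sume_distrr => [|S _]; last
  first.
  rewrite lee_fin mulr_ge0 ?tail_ge0// prodr_ge0// => e _.
  by have /andP[? ?] := next_prob01 M past e; case: ifP => _; rewrite ?subr_ge0.
apply: eq_bigr => S _; apply: etrans (IH (rcons past S)).2 _.
by rewrite size_rcons gov.2 EFinM muleA.
Qed.

Lemma missed_prob t :
  measurable [set w | missed G s y (snapshots Gs t w)] /\
  P [set w | missed G s y (snapshots Gs t w)] = (tail G M s y t [::])%:E.
Proof.
have := late_prob t [::]; rewrite /late /= add0n.
rewrite (_ : [set w | _ /\ _] = [set w | missed G s y (snapshots Gs t w)]).
  rewrite (_ : [set w | snapshots _ _ _ = _] = setT); last exact/seteqP.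
  by rewrite probability_setT mul1e.
by apply/seteqP; split => w //= -[].
Qed.

Lemma expected_arrival_tail : s != y ->
  expected_arrival G P Gs s y = (\sum_(0 <= t <oo) (tail G M s y t [::])%:E)%E.
Proof.
move=> sy; rewrite /expected_arrival.
pose D t := [set w | missed G s y (snapshots Gs t w)].
transitivity (\int[P]_w (\sum_(0 <= t <oo) (\1_(D t) w)%:E))%E.
  apply: eq_integral => w _; rewrite min_arrival_series//.
  apply: eq_eseriesr => t _; rewrite indicE /D.
  by rewrite mem_setE.
(* Monotone convergence. *)
rewrite integral_nneseries//; last first.
  by move=> t; apply/measurable_EFinP/measurable_indic; exact: (missed_prob
    t).1.
apply: eq_eseriesr => t _.
by rewrite integral_indic// ?setIT; [exact: (missed_prob t).2|exact:
  (missed_prob t).1].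
Qed.

End Law.

(** * Accuracy and running time *)

Section Estimate.
Variables (R : realType) (n m k : nat) (G : sgraph n m).
Variables (M : memory_model R m k) (s y : 'I_n) (eps : R).

Lemma nat_ceil (x : R) : 0 < x ->
  exists2 J : nat, (forall j : nat, (j%:R < x) = (j < J)%N) & J%:R < x + 1.
Proof.
move=> x0; have ex : exists j : nat, x <= j%:R.
  by exists (Num.truncn x).+1; rewrite ltW// truncnS_gt.
have [J xJ Jmin] := ex_minnP ex; exists J => [j|].
  by rewrite ltNge [RHS]ltnNge; congr (~~ _); apply/idP/idP => [/Jmin//|];
    rewrite -(ler_nat R); apply: le_trans.
case: J xJ Jmin => [|J] xJ Jmin; first by rewrite addr_gt0.
rewrite -natr1 ltrD2r ltNge; apply/negP => /Jmin; lia.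
Qed.

Lemma two_vertices : s != y -> (1 < n)%N.
Proof.
move=> sy; have : (s != y :> nat) by [].
by have := ltn_ord s; have := ltn_ord y; lia.
Qed.

Lemma reached_gpath past : y \in reached G s past -> exists es, gpath G s y es.
Proof.
(* Any list of snapshots comes from a temporal graph; the shift is due to times starting at 1. *)
have -> : past = upto (fun i => nth finset.set0 past i.-1) (size past).
  apply: (@eq_from_nth _ finset.set0); first by rewrite size_map size_iota.
  by move=> i ilt; rewrite (nth_map 0%N) ?size_iota// nth_iota.
by move=> /reached_journey[j [_ jp _] _]; exists (unzip1 j).
Qed.

Lemma unreachable_samples N r acc (F : nat -> R) :
  (forall past, missed G s y past) ->
  samples_expect G M s y N r acc F = F (acc + r * N)%N.
Proof.
move=> miss; have run K past a (H : nat -> R) :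
    run_expect G M s y K past a H = H (a + K)%N.
  elim: K past a => [|K IH] past a /=; first by rewrite addn0.
  under eq_next_expect do rewrite IH.
  by rewrite /next_expect subset_expect_cst miss -addnA.
elim: r acc => [|r IH] acc /=; first by rewrite mul0n addn0.
by rewrite run IH mulSn addnA.
Qed.

Section Accuracy.
Hypotheses (eps01 : 0 < eps < 1) (sy : s != y).

Definition estimate (N a : nat) : \bar R :=
  if a%:R / N%:R < N%:R :> R then (a%:R / N%:R)%:E else +oo%E.

(** [V], [e] and [t] stand for E [min (X, N)], E [X] and P (X > N). Sampling error and bias each
    take at most eps/2, relative to [V]; the average stays below [N], so the output is finite. *)
Lemma estimate_close (N a : nat) (Q V e t : R) : (0 < N)%N ->
  1 <= Q -> 4 * n%:R ^+ 2 * Q <= N%:R * eps ^+ 2 ->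
  1 <= V -> V <= n%:R * Q -> V <= e -> e <= V + n%:R * Q * t ->
  N%:R * t <= V -> `|a%:R - N%:R * V| <= N%:R * (eps / 2) * V ->
  ((1 - eps)%:E * e%:E <= estimate N a)%E && (estimate N a <= (1 + eps)%:E *
    e%:E)%E.
Proof.
move=> N0 Q1 hN V1 VQ Ve eV tV close; have /andP[e0 e1] := eps01.
have n2 : 2 <= n%:R :> R by rewrite ler_nat (two_vertices sy).
have Np : 0 < N%:R :> R by rewrite ltr0n.
have nQ : 4 * (n%:R * Q) <= N%:R * eps ^+ 2 by nra.
have nQ' : 4 * (n%:R * Q) <= N%:R * eps by nra.
have [r rN] : exists r, a%:R = N%:R * r :> R.
  by exists (a%:R / N%:R); rewrite mulrCA divff ?mulr1// gt_eqF.
have aN : a%:R / N%:R = r :> R by rewrite rN mulrAC divff ?mul1r// gt_eqF.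
move: close; rewrite rN -mulrBr normrM gtr0_norm// -mulrA ler_pM2l// => close.
have [c1 c2] : V - eps / 2 * V <= r /\ r <= V + eps / 2 * V.
  by move: close; rewrite ler_norml => /andP[? ?]; split; lra.
have eV' : e <= V * (1 + eps / 2).
  rewrite -(ler_pM2l Np); nra.
rewrite /estimate aN ifT; last by nra.
by rewrite -!EFinM !lee_fin; apply/andP; split; nra.
Qed.

Section Sampling.
Variables (N : nat) (Q : R).
Hypotheses (Q1 : 1 <= Q) (N0 : (0 < N)%N).
Hypothesis (prQ : forall e h, Q^-1 <= pr M e h).
Hypothesis hN : 4 * n%:R ^+ 2 * Q <= N%:R * eps ^+ 2.
Variables (d : measure_display) (T : measurableType d) (P : probability T R).
Variable Gs : nat -> T -> {set 'I_m}.
Hypothesis gov : governed_by P M Gs.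

Let E := expected_arrival G P Gs s y.

Definition good (a : nat) : R :=
  (((1 - eps)%:E * E <= estimate N a)%E && (estimate N a <= (1 + eps)%:E *
    E)%E)%:R.

(** The average is exactly [N], the strict test fails, and the output +oo is the true value. *)
Lemma good_unreachable :
  (~ exists es, gpath G s y es) -> 1 - 2 / n%:R <= samples_expect G M s y N N 0
    good.
Proof.
move=> nopath; have miss past : missed G s y past.
  by apply/negP => /reached_gpath.
rewrite unreachable_samples// add0n /good /estimate natrM -mulrA.
rewrite divff ?mulr1 ?ltxx; last by rewrite pnatr_eq0 -lt0n.
have -> : E = +oo%E.
  rewrite /E /expected_arrival (eq_integral (cst +oo%E)) => [|w _].
    rewrite integral_cst// -[RHS]mule1; congr (_ * _)%E.
    exact: probability_setT.
  rewrite /min_arrival (_ : [set _ | _ in _]%classic = classical_sets.set0)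
    ?ereal_inf0//.
  by apply/seteqP; split => // x [j [_ jp _] _]; case: nopath; exists (unzip1
    j).
have /andP[e0 e1] := eps01.
rewrite !gt0_muley ?lte_fin ?subr_gt0 ?addr_gt0// lexx.
by rewrite gerBl divr_ge0.
Qed.

Lemma good_reachable es :
  gpath G s y es -> 1 - 2 / n%:R <= samples_expect G M s y N N 0 good.
Proof.
move=> [vs [w _ wl]]; have /andP[e0 e1] := eps01.
have crossing (A : {set 'I_n}) : s \in A -> y \notin A ->
    exists e u v, [/\ u \in A, v \notin A & edge G e = [set u; v]%SET].
  exact: crossing_edge w wl.
set V := mean G M s y N [::]; set t := tail G M s y N [::].
have t0 : 0 <= t by apply: tail_ge0.
have missed0 : missed G s y [::] by rewrite /missed /reached /= inE eq_sym.
have V1 : 1 <= V.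
  rewrite /V; case: N N0 => // N' _; rewrite mean_tail big_ord_recl.
  rewrite -[X in X <= _]/(true%:R : R) -missed0 -[X in X <= _]/(tail G M s y 0
    [::]).
  by rewrite lerDl sumr_ge0// => i _; apply: tail_ge0.
have VQ : V <= n%:R * Q.
  by apply: le_trans (mean_le Q1 prQ crossing N [::]) _; rewrite missed0 mulr1.
have tV : N%:R * t <= V by apply: tail_mean.
have f0 i : (0 <= i)%N -> (0 <= (tail G M s y i [::])%:E)%E.
  by rewrite lee_fin tail_ge0.
have partial K : (\sum_(0 <= i < K) (tail G M s y i [::])%:E = (mean G M s y K
  [::])%:E)%E.
  by rewrite sumEFin mean_tail big_mkord.
have EV : (V%:E <= E)%E.
  by rewrite /E (expected_arrival_tail _ gov sy) -partial; apply:
    nneseries_lim_ge => i i0 _; exact: f0.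
have VE : (E <= (V + n%:R * Q * t)%:E)%E.
  rewrite /E (expected_arrival_tail _ gov sy); apply: lime_le.
    by apply: is_cvg_nneseries => i i0 _; exact: f0.
  exists N => // K /= NK; rewrite partial lee_fin -(subnKC NK).
  exact: mean_add_le.
have [e Ee] : exists e, E = e%:E.
  by move: EV VE; case: E => // e; exists e.
move: EV VE; rewrite Ee !lee_fin => EV VE.
have n0 : 0 < n%:R :> R by rewrite ltr0n (ltn_trans _ (two_vertices sy)).
have Np : 0 < N%:R :> R by rewrite ltr0n.
set eta := N%:R * (eps / 2) * V.
have eta0 : 0 < eta by rewrite !mulr_gt0 ?(lt_le_trans _ V1)// invr_gt0.
have good0 a : 0 <= good a by rewrite /good ler0n.
have good1 (a : nat) : `|a%:R - N%:R * V| <= eta -> 1 <= good a.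
  move=> close; rewrite /good Ee.
  by rewrite (estimate_close N0 Q1 hN V1 VQ EV VE tV close).
apply: le_trans (samples_expect_close eta0 good0 good1); rewrite -/V.
rewrite lerD2l lerN2 ler_pdivrMr ?exprn_gt0//.
have U := moment2_le Q1 prQ crossing N [::]; rewrite -/V in U.
(* The variance is at most the second moment, so the failure probability is at most 8 n Q / (N eps^2
   V), hence at most 2 / n by [hN] and V >= 1. *)
apply: (@le_trans _ _ (N%:R * (2 * n%:R * Q * V))).
  by rewrite ler_wpM2l// lerBlDr (le_trans U)// lerDl sqr_ge0.
have -> : 2 / n%:R * eta ^+ 2 = N%:R * (2 * V ^+ 2 * (N%:R * eps ^+ 2) / (4 *
  n%:R)).
  by rewrite /eta; field; rewrite gt_eqF.
rewrite ler_pM2l// ler_pdivlMr ?mulr_gt0//.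
apply: (@le_trans _ _ (2 * V ^+ 2 * (4 * n%:R ^+ 2 * Q))); last first.
  by rewrite ler_wpM2l// mulr_ge0// sqr_ge0.
have : 0 <= n%:R ^+ 2 * Q * V * (V - 1).
  by rewrite !mulr_ge0 ?subr_ge0// (le_trans ler01).
by nra.
Qed.

Lemma good_samples : 1 - 2 / n%:R <= samples_expect G M s y N N 0 good.
Proof.
have [[es /good_reachable]//|] := pselect (exists es, gpath G s y es).
exact: good_unreachable.
Qed.

End Sampling.
End Accuracy.
End Estimate.

(** The nested loops over samples, times and edges dominate; [maxn m 1] covers edgeless graphs. *)
Lemma total_cost_le n m J N : (0 < N)%N -> (n <= N)%N -> (J <= N)%N ->
  (total_cost n m J N <= 100 * (maxn m 1 * N ^ 2))%N.
Proof.
move=> N0 nN JN; set P := (maxn m 1 * N ^ 2)%N.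
have m1 : (m <= maxn m 1)%N by rewrite leq_maxl.
have m1' : (1 <= maxn m 1)%N by rewrite leq_maxr.
have h1 : (m * (N * N) <= P)%N by rewrite /P -mulnn leq_mul.
have h2 : (N * N <= P)%N by rewrite /P -mulnn leq_pmull.
have h3 : (N <= N * N)%N by rewrite leq_pmulr.
have h4 : (n * N <= N * N)%N by rewrite leq_mul.
have h5 : (m * N <= m * (N * N))%N by rewrite leq_mul.
rewrite /total_cost /sample_cost /time_cost /for_cost.
rewrite -[cost edge_step]/15%N -[cost scale_step]/3%N.
move: N0 JN h1 h2 h3 h4 h5; clearbody P; clear; nia.
Qed.

Theorem theorem7 (R : realType) :
  exists (A : cmd) (C : R),
  forall (eps : R) (k n m : nat) (G : sgraph n m) (s y : 'I_n)
         (M : memory_model R m k) (c : R),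
    0 < eps < 1 -> s != y -> 1 <= c ->
    (forall (e : 'I_m) (h : k.-tuple bool), (n%:R `^ c)^-1 <= pr M e h) ->
    exists N : nat,
      [/\ N%:R <= C * ((maxn m 1)%:R * (n%:R `^ (5 * c + 8) / eps ^+ 4)
                       * ln (n%:R / eps)),
          prob N [:: A] (input G M s y eps c) xpredT = 1
        & forall (d : measure_display) (T : measurableType d)
                 (P : probability T R) (Gs : nat -> T -> {set 'I_m}),
            governed_by P M Gs ->
            1 - 2 / n%:R <=
              prob N [:: A] (input G M s y eps c)
                (accurate eps (expected_arrival G P Gs s y))].
Proof.
(* 100 comes from [total_cost_le], 25 from squaring N <= 5 n^(c+3) / eps^2, and ln 2 is a lower
   bound for ln (n / eps). *)
exists algorithm, (100 * 25 / ln 2) => eps k n m G s y M c eps01 sy c1 prc.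
have /andP[e0 e1] := eps01.
have n2N := two_vertices sy.
have n2 : 2 <= n%:R :> R by rewrite ler_nat.
have n1 : 1 <= n%:R :> R by apply: le_trans n2; rewrite ler1n.
have n0 : 0 < n%:R :> R by apply: lt_le_trans n1.
have [J Jc Jlt] := nat_ceil (lt_le_trans ltr01 c1).
pose Q : R := n%:R ^+ J; pose z := 4 * (n%:R * n%:R) / (eps * eps).
have Q1 : 1 <= Q by rewrite exprn_ege1.
have ee0 : 0 < eps * eps by rewrite mulr_gt0.
have z0 : 0 < z * Q.
  by rewrite !mulr_gt0 ?invr_gt0//; exact: lt_le_trans Q1.
have [N Nz Nlt] := nat_ceil z0.
have N0 : (0 < N)%N by rewrite -Nz.
have zN : z * Q <= N%:R by rewrite leNgt Nz ltnn.
have hN : 4 * n%:R ^+ 2 * Q <= N%:R * eps ^+ 2.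
  move: zN; rewrite /z mulrAC ler_pdivrMr//.
have QJ : Q = n%:R `^ J%:R by rewrite powR_mulrn.
have prQ e h : Q^-1 <= pr M e h.
  apply: le_trans (prc e h); rewrite lef_pV2 ?posrE ?powR_gt0//; last exact:
    lt_le_trans Q1.
  by rewrite QJ ler_powR// leNgt Jc ltnn.
have ee1 : eps * eps <= 1 by nra.
have zn : n%:R <= n%:R * n%:R / (eps * eps).
  by rewrite ler_pdivlMr// ler_pM2l// (le_trans ee1).
have zE : z * Q = 4 * (n%:R * n%:R / (eps * eps) * Q) by rewrite /z !mulrA.
have QN : Q <= N%:R by apply: le_trans zN; rewrite zE; nra.
have JN : (J <= N)%N.
  rewrite -(ler_nat R); apply: le_trans QN; rewrite /Q -natrX ler_nat.
  exact/ltnW/ltn_expl.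
have nN : (n <= N)%N.
  by rewrite -(ler_nat R); apply: le_trans zN; rewrite zE; nra.
exists (total_cost n m J N).
have spec F Q' := @algorithm_ensures R n m k G M s y eps c J N F Q'
  (fun j _ => Jc j) (fun i _ => Nz i).
split.
- apply: (@le_trans _ _ (100 * ((maxn m 1)%:R * N%:R ^+ 2))).
    by rewrite -natrX -!natrM ler_nat; exact: total_cost_le.
  pose W := n%:R `^ (c + 3).
  have powD (a b : R) : n%:R `^ a * n%:R `^ b = n%:R `^ (a + b).
    by rewrite powRD// (gt_eqF n0) implybT.
  have nnQ : n%:R * n%:R * Q <= W.
    rewrite -expr2 -powR_mulrn ?(ltW n0)// QJ powD ler_powR//.
    lra.
  (* 4 from the definition of [z], plus 1 for rounding up. *)
  have NW : N%:R <= 5 * W / (eps * eps).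
    apply: (@le_trans _ _ (z * Q + 1)); first exact: ltW.
    have : n%:R * n%:R / (eps * eps) * Q <= W / (eps * eps).
      by rewrite mulrAC ler_wpM2r// invr_ge0 ltW.
    have : 1 <= n%:R * n%:R / (eps * eps) * Q.
      by rewrite mulr_ege1// (le_trans n1).
    by rewrite zE -[5 * W / _]mulrA; lra.
  have N2 : N%:R ^+ 2 <= 25 * (n%:R `^ (5 * c + 8) / eps ^+ 4).
    apply: (@le_trans _ _ ((5 * W / (eps * eps)) ^+ 2)).
      by rewrite lerXn2r ?nnegrE// (le_trans _ NW).
    have -> : (5 * W / (eps * eps)) ^+ 2 = 25 * (W * W / eps ^+ 4).
      by field; rewrite gt_eqF.
    (* The exponent 2 (c + 3) is below 5 c + 8. *)
    rewrite ler_pM2l// ler_pM2r ?invr_gt0 ?exprn_gt0// powD ler_powR//; lra.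
  have ln2 : 0 < ln (2 : R) by apply: ln_gt0; rewrite ltr1n.
  have lnn : ln 2 <= ln (n%:R / eps).
    by rewrite ler_ln ?posrE ?divr_gt0// ler_pdivlMr//; lra.
  set B := n%:R `^ (5 * c + 8) / eps ^+ 4 in N2 *.
  have B0 : 0 <= B by apply: (mulr_ge0 (powR_ge0 _ _)); rewrite invr_ge0
    exprn_ge0// ltW.
  have m0 : 0 <= (maxn m 1)%:R :> R by [].
  apply: (@le_trans _ _ (100 * 25 / ln 2 * ((maxn m 1)%:R * B * ln 2))); last
    first.
    by rewrite ler_wpM2l ?divr_ge0 ?mulr_ge0 ?(ltW ln2) ?ler0n// ler_wpM2l//
      mulr_ge0.
  have -> : 100 * 25 / ln 2 * ((maxn m 1)%:R * B * ln 2) =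
      100 * ((maxn m 1)%:R * (25 * B)).
    by field; rewrite gt_eqF.
  by rewrite ler_pM2l// ler_wpM2l.
- apply/eqP; rewrite eq_le.
  have /andP[_ ->] := prob_bounds (total_cost n m J N) [:: algorithm]
    (input G M s y eps c) xpredT.
  (* With [F] constantly 1, the specification says that the program halts in time. *)
  by apply: le_trans (spec (fun=> 1) xpredT _) => //; rewrite
    samples_expect_cst.
- move=> d T P Gs gov.
  apply: le_trans (good_samples G eps01 sy Q1 N0 prQ hN gov) _; apply: spec =>
    st a out.
  by rewrite /accurate /good out.
Qed.
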